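(* Let $\mathfrak{C}$ be an $A$-coring with ${}_A\mathfrak{C}$ flat, $B$ a $k$-algebra, and let $\Lambda\in{}_B\mathcal{M}^{\mathfrak{C}}$ be a $(B,\mathfrak{C})$-bicomodule, quasi-finite as a right $\mathfrak{C}$-comodule. Set $X=\mathrm{h}_{\mathfrak{C}}(\Lambda,\mathfrak{C})\in{}^{\mathfrak{C}}\mathcal{M}_B$. If $\mathfrak{C}_A$ is flat and the cohom functor $\mathrm{h}_{\mathfrak{C}}(\Lambda,-)$ is exact, or if $\mathfrak{C}$ is a coseparable coring, then: (1) The functor $-\otimes_B\Lambda:\mathcal{M}_B\to\mathcal{M}^{\mathfrak{C}}$ is separable if and only if the comatrix coring $\Lambda\square_{\mathfrak{C}}X$ is a cosplit $B$-coring. (2) If the cohom functor $\mathrm{h}_{\mathfrak{C}}(\Lambda,-)$ is separable then the comatrix coring $\Lambda\square_{\mathfrak{C}}X$ is a coseparable $B$-coring. (3) If $-\otimes_B\Lambda:\mathcal{M}_B\to\mathcal{M}^{\mathfrak{C}}$ is a Frobenius functor, either $X_B$ is flat and $\Lambda_{\mathfrak{C}}$ is coflat or $\mathfrak{C}$ is coseparable, and if $bH(f)=H(f)b$ for all $f\in(\Lambda\square_{\mathfrak{C}}X)^*$ and all $b\in B$, where $H:(\Lambda\square_{\mathfrak{C}}X)^*\to\Lambda\square_{\mathfrak{C}}X$ is the isomorphism $H(f)=(f\otimes_B(\Lambda\square_{\mathfrak{C}}X))\,\Delta\,(\xi_B(1_B))$ (this condition holds if $B=k$), then the comatrix coring $\Lambda\square_{\mathfrak{C}}X$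 is a Frobenius $B$-coring.
   Context: $k$ is a commutative ring; $A,B$ are associative unital $k$-algebras. An $A$-coring is an $A$-bimodule $\mathfrak{C}$ with $A$-bimodule maps $\Delta_{\mathfrak C}:\mathfrak{C}\to\mathfrak{C}\otimes_A\mathfrak{C}$ (coassociative) and $\epsilon_{\mathfrak C}:\mathfrak{C}\to A$ (counit). $\mathcal M^{\mathfrak C}$ is the category of right $\mathfrak C$-comodules $(M,\rho_M)$; left comodules have coaction $\lambda$. A $(B,\mathfrak C)$-bicomodule is a $(B,A)$-bimodule with a $B$-linear right $\mathfrak C$-coaction (similarly ${}^{\mathfrak C}\mathcal M_B$). $M\square_{\mathfrak{C}}N=\ker(\rho_M\otimes_AN-M\otimes_A\lambda_N)\subset M\otimes_AN$. A right comodule $M$ is coflat if $M\square_{\mathfrak C}-$ is exact. $\Lambda$ quasi-finite: $-\otimes_B\Lambda:\mathcal M_B\to\mathcal M^{\mathfrak C}$ has a left adjoint $\mathrm h_{\mathfrak C}(\Lambda,-):\mathcal M^{\mathfrak C}\to\mathcal M_B$ (cohom functor) with unit $\theta_M:M\to\mathrm h_{\mathfrak C}(\Lambda,M)\otimes_B\Lambda$. $X=\mathrm h_{\mathfrak C}(\Lambda,\mathfrak C)$ has left $A$-action by functoriality and left coaction $\mathrm h_{\mathfrak C}(\Lambda,\Delta_{\mathfrak C}):X\to\mathrm h_{\mathfrak C}(\Lambda,\mathfrak C\otimes_A\mathfrak C)\simeq\mathfrak C\otimes_AX$. Under the hypotheses $\mathrm h_{\mathfrak C}(\Lambda,-)\simeq-\square_{\mathfrak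 C}X$, so $(-\square_{\mathfrak C}X,-\otimes_B\Lambda)$ is an adjoint pair, with unit $M\simeq M\square_{\mathfrak C}\mathfrak C\xrightarrow{M\square\theta_{\mathfrak C}}M\square_{\mathfrak C}X\otimes_B\Lambda$ and counit $V\otimes_B\omega$ ($V\in\mathcal M_B$) for a unique $B$-bimodule map $\omega:\Lambda\square_{\mathfrak C}X\to B$. The comatrix coring is the $B$-coring $\Lambda\square_{\mathfrak C}X$ with coproduct $\Delta:\Lambda\square_{\mathfrak C}X\simeq\Lambda\square_{\mathfrak C}\mathfrak C\square_{\mathfrak C}X\xrightarrow{\Lambda\square\theta_{\mathfrak C}\square X}(\Lambda\square_{\mathfrak C}X)\otimes_B(\Lambda\square_{\mathfrak C}X)$ and counit $\omega$. $(\Lambda\square_{\mathfrak C}X)^*$ is the set of right $B$-linear maps $\Lambda\square_{\mathfrak C}X\to B$. If $-\otimes_B\Lambda$ is Frobenius, then its left adjoint $-\square_{\mathfrak C}X$ is also a right adjoint, and $\xi:1_{\mathcal M_B}\to-\otimes_B\Lambda\square_{\mathfrak C}X$ is the unit of the adjunction $(-\otimes_B\Lambda,-\square_{\mathfrak C}X)$; $\xi_B(1_B)$ is viewed in $B\otimes_B\Lambda\square_{\mathfrak C}X\simeq\Lambda\square_{\mathfrak C}X$, and $B\otimes_B(\Lambda\square_{\mathfrak C}X)$ is identified with $\Lambda\square_{\mathfrak C}X$. A functor $T:\mathbf C\to\mathbf D$ is separable if the natural transformation $\mathrm{Hom}_{\mathbf C}(-,-)\to\mathrm{Hom}_{\mathbf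 D}(T(-),T(-))$ has a natural left inverse. A functor is Frobenius if some functor is both a left and a right adjoint of it. A $B$-coring $\mathfrak E$ is cosplit if $\epsilon_{\mathfrak E}$ is a split epimorphism of $B$-bimodules; coseparable if $\Delta_{\mathfrak E}$ is a split monomorphism of $\mathfrak E$-bicomodules; Frobenius if the forgetful functor $\mathcal M^{\mathfrak E}\to\mathcal M_B$ is a Frobenius functor. *)

(* Defs.v *)
From HB Require Import structures.
From mathcomp Require Import all_boot all_algebra boolp.

Set Implicit Arguments.
Unset Strict Implicit.
Unset Printing Implicit Defensive.

Import GRing.Theory.
Local Open Scope ring_scope.
Local Open Scope quotient_scope.

(* [algType k] would exclude the zero algebra. *)
Record alg (k : comPzRingType) := Alg {
  alg_ring :> pzRingType;
  alg_str : {rmorphism k -> alg_ring};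
  alg_central : forall (c : k) (x : alg_ring), alg_str c * x = x * alg_str c
}.

Definition base_alg (k : comPzRingType) : alg k :=
  @Alg k k idfun (fun c x => mulrC c x).

(* The two induced k-actions of a bimodule over k-algebras coincide
   ([act_sym]). With R the base algebra, a bimodule is therefore the same thing
   as a right S-module, and symmetrically on the other side. *)
Record bimod (k : comPzRingType) (R S : alg k) := Bimod {
  bcar :> zmodType;
  lact : R -> bcar -> bcar;
  ract : bcar -> S -> bcar;
  lactDl : forall r s x, lact (r + s) x = lact r x + lact s x;
  lactDr : forall r x y, lact r (x + y) = lact r x + lact r y;
  lactM : forall r s x, lact (r * s) x = lact r (lact s x);
  lact1 : forall x, lact 1 x = x;
  ractDl : forall x y s, ract (x + y) s = ract x s + ract y s;
  ractDr : forall x r s, ract x (r + s) = ract x r + ract x s;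
  ractM : forall x r s, ract x (r * s) = ract (ract x r) s;
  ract1 : forall x, ract x 1 = x;
  lractA : forall r x s, ract (lact r x) s = lact r (ract x s);
  act_sym : forall (c : k) x, lact (alg_str R c) x = ract x (alg_str S c)
}.

Notation rmod B := (bimod (base_alg _) B).
Notation lmod A := (bimod A (base_alg _)).

Record bihom (k : comPzRingType) (R S : alg k) (M N : bimod R S) := Bihom {
  bfun :> M -> N;
  bhomD : forall x y, bfun (x + y) = bfun x + bfun y;
  bhoml : forall r x, bfun (lact r x) = lact r (bfun x);
  bhomr : forall x s, bfun (ract x s) = ract (bfun x) s
}.

Lemma bihom_ext (k : comPzRingType) (R S : alg k) (M N : bimod R S)
  (f g : bihom M N) : (forall x, f x = g x) -> f = g.
Proof.
case: f g => [f Df lf rf] [g Dg lg rg] /= /funext fg.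
by subst g; congr Bihom; apply: Prop_irrelevance.
Qed.

Definition bid (k : comPzRingType) (R S : alg k) (M : bimod R S) : bihom M M :=
  @Bihom k R S M M id (fun _ _ => erefl) (fun _ _ => erefl) (fun _ _ => erefl).

Definition bcomp (k : comPzRingType) (R S : alg k) (M N P : bimod R S)
  (g : bihom N P) (f : bihom M N) : bihom M P.
Proof.
by exists (fun x => g (f x)) => *; rewrite ?bhomD ?bhoml ?bhomr.
Defined.

Definition regular_bimod (k : comPzRingType) (R : alg k) : bimod R R :=
  @Bimod k R R R *%R *%R (fun r s x => mulrDl r s x) (fun r x y => mulrDr r x y)
    (fun r s x => esym (mulrA r s x)) (@mul1r R) (fun x y s => mulrDl x y s)
    (fun x r s => mulrDr x r s) (fun x r s => mulrA x r s) (@mulr1 R)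
    (fun r x s => esym (mulrA r x s)) (@alg_central k R).

Section ForgetLeft.
Variables (k : comPzRingType) (R S : alg k) (M : bimod R S).

Let lk (c : k) (x : M) : M := lact (alg_str R c) x.

Lemma forget_lactDl c d x : lk (c + d) x = lk c x + lk d x.
Proof. by rewrite /lk rmorphD lactDl. Qed.
Lemma forget_lactM c d x : lk (c * d) x = lk c (lk d x).
Proof. by rewrite /lk rmorphM lactM. Qed.
Lemma forget_lact1 x : lk 1 x = x.
Proof. by rewrite /lk rmorph1 lact1. Qed.

Definition forget_left : rmod S :=
  @Bimod k (base_alg k) S M lk (@ract k R S M) forget_lactDl
    (fun c x y => lactDr (alg_str R c) x y) forget_lactM forget_lact1
    (@ractDl k R S M) (@ractDr k R S M) (@ractM k R S M) (@ract1 k R S M)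
    (fun c x s => lractA (alg_str R c) x s) (@act_sym k R S M).

End ForgetLeft.

(* The congruence on formal sums of pairs that presents the tensor product. It
   depends on the two actions only as functions, so that restricting scalars on
   the outer sides leaves the underlying group of a tensor product unchanged up
   to conversion. Opposites come for free from the rules. *)
Section RawTensor.
Variables (M N : zmodType) (S : Type) (ra : M -> S -> M) (la : S -> N -> N).

Inductive tensor_rel : seq (M * N) -> seq (M * N) -> Prop :=
| TensorRefl u : tensor_rel u u
| TensorSym u v : tensor_rel u v -> tensor_rel v u
| TensorTrans u v w : tensor_rel u v -> tensor_rel v w -> tensor_rel u w
| TensorCat u u' v v' :
    tensor_rel u u' -> tensor_rel v v' -> tensor_rel (u ++ v) (u' ++ v')
| TensorComm u v : tensor_rel (u ++ v) (v ++ u)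
| TensorZero n : tensor_rel [:: (0, n)] [::]
| TensorDl m m' n : tensor_rel [:: (m + m', n)] [:: (m, n); (m', n)]
| TensorDr m n n' : tensor_rel [:: (m, n + n')] [:: (m, n); (m, n')]
| TensorBalanced m s n : tensor_rel [:: (ra m s, n)] [:: (m, la s n)].

Definition tensor_relb (u v : seq (M * N)) : bool := `[< tensor_rel u v >].

Lemma tensor_relb_refl : reflexive tensor_relb.
Proof. by move=> u; apply/asboolP; constructor. Qed.

Lemma tensor_relb_sym : symmetric tensor_relb.
Proof. by move=> u v; apply/asboolP/asboolP; apply: TensorSym. Qed.

Lemma tensor_relb_trans : transitive tensor_relb.
Proof.
by move=> v u w /asboolP uv /asboolP vw; apply/asboolP; apply: TensorTrans uv vw.
Qed.

Canonical tensor_equiv :=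
  EquivRel tensor_relb tensor_relb_refl tensor_relb_sym tensor_relb_trans.

Definition tensor : Type := {eq_quot tensor_equiv}.
HB.instance Definition _ := Choice.on tensor.
HB.instance Definition _ := EqQuotient.on tensor.

Let tensor_opp_seq (u : seq (M * N)) := [seq (- p.1, p.2) | p <- u].

Definition tensor_zero : tensor := \pi_tensor [::].
Definition tensor_add (x y : tensor) : tensor := \pi_tensor (repr x ++ repr y).
Definition tensor_opp (x : tensor) : tensor := \pi_tensor (tensor_opp_seq (repr x)).

Lemma tensor_piP u v : tensor_rel u v <-> \pi_tensor u = \pi_tensor v.
Proof. by split=> [uv|/eqmodP/asboolP//]; apply/eqmodP/asboolP. Qed.

Lemma tensor_repr u : tensor_rel (repr (\pi_tensor u)) u.
Proof. by apply/tensor_piP; rewrite reprK. Qed.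

Lemma tensor_addE u v :
  tensor_add (\pi_tensor u) (\pi_tensor v) = \pi_tensor (u ++ v).
Proof. by apply/tensor_piP/TensorCat; apply: tensor_repr. Qed.

Lemma tensor_addC : commutative tensor_add.
Proof. by move=> x y; apply/tensor_piP/TensorComm. Qed.

Lemma tensor_addA : associative tensor_add.
Proof.
move=> x y z; elim/quotW: x => u; elim/quotW: y => v; elim/quotW: z => w.
by rewrite (tensor_addE v w) (tensor_addE u v) !tensor_addE catA.
Qed.

Lemma tensor_add0 : left_id tensor_zero tensor_add.
Proof. by move=> x; elim/quotW: x => u; rewrite tensor_addE. Qed.

Lemma tensor_oppK : left_inverse tensor_zero tensor_opp tensor_add.
Proof.
move=> x; rewrite -{2}[x]reprK tensor_addE; apply/tensor_piP.
elim: (repr x) => [|[m n] u IHu] /=; first exact: TensorRefl.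
rewrite -cat1s -[_ :: u]cat1s catA.
apply: (TensorTrans (v := [:: (- m, n)] ++ ([:: (m, n)] ++ (tensor_opp_seq u ++ u)))).
  rewrite -catA; apply: TensorCat; first exact: TensorRefl.
  by rewrite !catA; apply: TensorCat (TensorRefl _); apply: TensorComm.
rewrite catA -[X in tensor_rel _ X]cat0s; apply: TensorCat => //.
apply: TensorTrans (TensorZero n); rewrite -(addNr m).
exact/TensorSym/TensorDl.
Qed.

HB.instance Definition _ := GRing.isZmodule.Build tensor
  tensor_addA tensor_addC tensor_add0 tensor_oppK.

Definition tpure (m : M) (n : N) : tensor := \pi_tensor [:: (m, n)].

Lemma tpureDl m m' n : tpure (m + m') n = tpure m n + tpure m' n.
Proof. by rewrite [RHS]tensor_addE; apply/tensor_piP/TensorDl. Qed.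

Lemma tpureDr m n n' : tpure m (n + n') = tpure m n + tpure m n'.
Proof. by rewrite [RHS]tensor_addE; apply/tensor_piP/TensorDr. Qed.

Lemma tpure_bal m s n : tpure (ra m s) n = tpure m (la s n).
Proof. by apply/tensor_piP/TensorBalanced. Qed.

Lemma tpure0 n : tpure 0 n = 0.
Proof. by apply/tensor_piP/TensorZero. Qed.

Lemma tensor_ind (P : tensor -> Prop) :
  (forall m n, P (tpure m n)) -> (forall x y, P x -> P y -> P (x + y)) ->
  forall z, P z.
Proof.
move=> Pp PD z; rewrite -[z]reprK; elim: (repr z) => [|[m n] u IHu].
  by have := Pp 0 0; rewrite tpure0.
have -> : \pi_tensor ((m, n) :: u) = tpure m n + \pi_tensor u.
  by rewrite [RHS]tensor_addE.
exact: PD.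
Qed.

Lemma tensor_ext (Z : zmodType) (f g : tensor -> Z) :
    (forall x y, f (x + y) = f x + f y) -> (forall x y, g (x + y) = g x + g y) ->
    (forall m n, f (tpure m n) = g (tpure m n)) ->
  forall z, f z = g z.
Proof.
by move=> fD gD fg; apply: tensor_ind => // x y fx fy; rewrite fD gD fx fy.
Qed.

Definition balanced (Z : zmodType) (f : M -> N -> Z) : Prop :=
  [/\ forall m m' n, f (m + m') n = f m n + f m' n,
      forall m n n', f m (n + n') = f m n + f m n'
    & forall m s n, f (ra m s) n = f m (la s n)].

(* The map induced on the tensor product, meaningful for balanced [f]. *)
Definition tlift (Z : zmodType) (f : M -> N -> Z) (x : tensor) : Z :=
  \sum_(p <- repr x) f p.1 p.2.

Lemma tlift_pi (Z : zmodType) (f : M -> N -> Z) u : balanced f ->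
  tlift f (\pi_tensor u) = \sum_(p <- u) f p.1 p.2.
Proof.
case=> fDl fDr fb; rewrite /tlift.
move: (repr _) (tensor_repr u) => v; elim=> //= {u v}.
- by move=> u v w _ -> _ ->.
- by move=> u u' v v' _ IHu _ IHv; rewrite !big_cat IHu IHv.
- by move=> u v; rewrite !big_cat; exact: addrC.
- move=> n; rewrite big_seq1 big_nil /=.
  by apply: (addrI (f 0 n)); rewrite -fDl !addr0.
- by move=> m m' n; rewrite big_seq1 big_cons big_seq1 fDl.
- by move=> m n n'; rewrite big_seq1 big_cons big_seq1 fDr.
- by move=> m s n; rewrite !big_seq1 fb.
Qed.

Lemma tliftE (Z : zmodType) (f : M -> N -> Z) m n : balanced f ->
  tlift f (tpure m n) = f m n.
Proof. by move=> fb; rewrite tlift_pi // big_seq1. Qed.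

Lemma tliftD (Z : zmodType) (f : M -> N -> Z) x y : balanced f ->
  tlift f (x + y) = tlift f x + tlift f y.
Proof.
move=> fb; rewrite -[x]reprK -[y]reprK [X in tlift f X]tensor_addE !tlift_pi //.
exact: big_cat.
Qed.

End RawTensor.

Section TensorBimod.
Variables (k : comPzRingType) (R S T : alg k) (M : bimod R S) (N : bimod S T).

Local Notation MN := (tensor (@ract k R S M) (@lact k S T N)).
Local Notation "m '#' n" :=
  (tpure (@ract k R S M) (@lact k S T N) m n) (at level 40).

Lemma balanced_lact r :
  balanced (@ract k R S M) (@lact k S T N) (fun m n => lact r m # n).
Proof.
split=> [m m' n|m n n'|m s n]; first by rewrite lactDr tpureDl.
  exact: tpureDr.
by rewrite -lractA tpure_bal.
Qed.

Lemma balanced_ract t :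
  balanced (@ract k R S M) (@lact k S T N) (fun m n => m # ract n t).
Proof.
split=> [m m' n|m n n'|m s n]; first exact: tpureDl.
  by rewrite ractDl tpureDr.
by rewrite tpure_bal lractA.
Qed.

Definition tens_lact (r : R) : MN -> MN := tlift (fun m n => lact r m # n).
Definition tens_ract (x : MN) (t : T) : MN := tlift (fun m n => m # ract n t) x.

Lemma tens_lactE r m n : tens_lact r (m # n) = lact r m # n.
Proof. by rewrite /tens_lact tliftE //; apply: balanced_lact. Qed.
Lemma tens_ractE m n t : tens_ract (m # n) t = m # ract n t.
Proof. by rewrite /tens_ract tliftE //; apply: balanced_ract. Qed.
Lemma tens_lactD r x y : tens_lact r (x + y) = tens_lact r x + tens_lact r y.
Proof. by rewrite /tens_lact tliftD //; apply: balanced_lact. Qed.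
Lemma tens_ractD x y t : tens_ract (x + y) t = tens_ract x t + tens_ract y t.
Proof. by rewrite /tens_ract tliftD //; apply: balanced_ract. Qed.

Lemma tens_lactDl r s x : tens_lact (r + s) x = tens_lact r x + tens_lact s x.
Proof.
elim/tensor_ind: x => [m n|x y IHx IHy].
  by rewrite !tens_lactE lactDl tpureDl.
by rewrite !tens_lactD IHx IHy addrACA.
Qed.

Lemma tens_lactM r s x : tens_lact (r * s) x = tens_lact r (tens_lact s x).
Proof.
elim/tensor_ind: x => [m n|x y IHx IHy].
  by rewrite !tens_lactE lactM.
by rewrite !tens_lactD IHx IHy.
Qed.

Lemma tens_lact1 x : tens_lact 1 x = x.
Proof.
elim/tensor_ind: x => [m n|x y IHx IHy]; first by rewrite tens_lactE lact1.
by rewrite tens_lactD IHx IHy.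
Qed.

Lemma tens_ractDr x s t : tens_ract x (s + t) = tens_ract x s + tens_ract x t.
Proof.
elim/tensor_ind: x => [m n|x y IHx IHy].
  by rewrite !tens_ractE ractDr tpureDr.
by rewrite !tens_ractD IHx IHy addrACA.
Qed.

Lemma tens_ractM x s t : tens_ract x (s * t) = tens_ract (tens_ract x s) t.
Proof.
elim/tensor_ind: x => [m n|x y IHx IHy].
  by rewrite !tens_ractE ractM.
by rewrite !tens_ractD IHx IHy.
Qed.

Lemma tens_ract1 x : tens_ract x 1 = x.
Proof.
elim/tensor_ind: x => [m n|x y IHx IHy]; first by rewrite tens_ractE ract1.
by rewrite tens_ractD IHx IHy.
Qed.

Lemma tens_lractA r x t : tens_ract (tens_lact r x) t = tens_lact r (tens_ract x t).
Proof.
elim/tensor_ind: x => [m n|x y IHx IHy].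
  by rewrite tens_lactE !tens_ractE tens_lactE.
by rewrite tens_lactD !tens_ractD tens_lactD IHx IHy.
Qed.

Lemma tens_act_sym (c : k) x :
  tens_lact (alg_str R c) x = tens_ract x (alg_str T c).
Proof.
elim/tensor_ind: x => [m n|x y IHx IHy].
  by rewrite tens_lactE tens_ractE act_sym tpure_bal act_sym.
by rewrite tens_lactD tens_ractD IHx IHy.
Qed.

Definition tens : bimod R T := Bimod tens_lactDl tens_lactD tens_lactM tens_lact1
  tens_ractD tens_ractDr tens_ractM tens_ract1 tens_lractA tens_act_sym.

Definition pure (m : M) (n : N) : tens := m # n.

Lemma pureDl m m' n : pure (m + m') n = pure m n + pure m' n.
Proof. exact: tpureDl. Qed.
Lemma pureDr m n n' : pure m (n + n') = pure m n + pure m n'.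
Proof. exact: tpureDr. Qed.
Lemma pure_bal m s n : pure (ract m s) n = pure m (lact s n).
Proof. exact: tpure_bal. Qed.
Lemma lact_pure r m n : lact r (pure m n) = pure (lact r m) n.
Proof. exact: tens_lactE. Qed.
Lemma ract_pure m n t : ract (pure m n) t = pure m (ract n t).
Proof. exact: tens_ractE. Qed.

Lemma tens_ind (P : tens -> Prop) :
  (forall m n, P (pure m n)) -> (forall x y, P x -> P y -> P (x + y)) ->
  forall z, P z.
Proof. exact: tensor_ind. Qed.

Lemma tens_ext (Z : zmodType) (f g : tens -> Z) :
    (forall x y, f (x + y) = f x + f y) -> (forall x y, g (x + y) = g x + g y) ->
    (forall m n, f (pure m n) = g (pure m n)) ->
  forall z, f z = g z.
Proof. exact: tensor_ext. Qed.

Section Lift.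
Variables (P : bimod R T) (f : M -> N -> P).
Hypothesis fb : balanced (@ract k R S M) (@lact k S T N) f.
Hypothesis fl : forall r m n, f (lact r m) n = lact r (f m n).
Hypothesis fr : forall m n t, f m (ract n t) = ract (f m n) t.

Lemma tens_liftD x y : tlift f (x + y : tens) = tlift f x + tlift f y.
Proof. exact: tliftD. Qed.

Lemma tens_liftl r (x : tens) : tlift f (lact r x) = lact r (tlift f x).
Proof.
elim/tens_ind: x => [m n|x y IHx IHy].
  by rewrite lact_pure !tliftE.
by rewrite lactDr !tens_liftD lactDr IHx IHy.
Qed.

Lemma tens_liftr (x : tens) t : tlift f (ract x t) = ract (tlift f x) t.
Proof.
elim/tens_ind: x => [m n|x y IHx IHy].
  by rewrite ract_pure !tliftE.
by rewrite ractDl !tens_liftD ractDl IHx IHy.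
Qed.

Definition tens_lift : bihom tens P := Bihom tens_liftD tens_liftl tens_liftr.

Lemma tens_liftE m n : tens_lift (pure m n) = f m n.
Proof. exact: tliftE. Qed.

End Lift.

End TensorBimod.

Arguments pure {k R S T M N}.

Section TensorMaps.
Variable k : comPzRingType.

Section Tmap.
Variables (R S T : alg k) (M M' : bimod R S) (N N' : bimod S T).
Variables (f : bihom M M') (g : bihom N N').

Let fg (m : M) (n : N) : tens M' N' := pure (f m) (g n).

Lemma tmap_balanced : balanced (@ract k R S M) (@lact k S T N) fg.
Proof.
by split=> *; rewrite /fg ?bhomD ?pureDl ?pureDr ?bhomr ?bhoml ?pure_bal.
Qed.
Lemma tmap_lact r m n : fg (lact r m) n = lact r (fg m n).
Proof. by rewrite /fg bhoml lact_pure. Qed.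
Lemma tmap_ract m n t : fg m (ract n t) = ract (fg m n) t.
Proof. by rewrite /fg bhomr ract_pure. Qed.

Definition tmap : bihom (tens M N) (tens M' N') :=
  tens_lift tmap_balanced tmap_lact tmap_ract.

Lemma tmapE m n : tmap (pure m n) = pure (f m) (g n).
Proof. exact: tens_liftE. Qed.

End Tmap.

Section Assoc.
Variables (R S T U : alg k) (M : bimod R S) (N : bimod S T) (P : bimod T U).

Definition tassoc_aux (p : P) : tens M N -> tens M (tens N P) :=
  tlift (fun m n => pure m (pure n p)).

Lemma tassoc_aux_balanced (p : P) :
  balanced (@ract _ _ _ M) (@lact _ _ _ N)
    (fun m n => pure m (pure n p) : tens M (tens N P)).
Proof.
split=> *; first exact: pureDl.
  by rewrite pureDl pureDr.
by rewrite pure_bal lact_pure.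
Qed.

Lemma tassoc_auxE p m n : tassoc_aux p (pure m n) = pure m (pure n p).
Proof. exact: tliftE (tassoc_aux_balanced p). Qed.
Lemma tassoc_auxD p x y : tassoc_aux p (x + y) = tassoc_aux p x + tassoc_aux p y.
Proof. exact: tliftD (tassoc_aux_balanced p). Qed.

Lemma tassoc_balanced :
  balanced (@ract _ _ _ (tens M N)) (@lact _ _ _ P) (fun x p => tassoc_aux p x).
Proof.
split=> [x y p|x p q|x t p]; first exact: tassoc_auxD.
  elim/tens_ind: x => [m n|x y IHx IHy]; first by rewrite !tassoc_auxE !pureDr.
  by rewrite !tassoc_auxD IHx IHy addrACA.
elim/tens_ind: x => [m n|x y IHx IHy].
  by rewrite ract_pure !tassoc_auxE pure_bal.
by rewrite ractDl !tassoc_auxD IHx IHy.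
Qed.

Lemma tassoc_lact r (x : tens M N) p :
  tassoc_aux p (lact r x) = lact r (tassoc_aux p x).
Proof.
elim/tens_ind: x => [m n|x y IHx IHy].
  by rewrite lact_pure !tassoc_auxE lact_pure.
by rewrite lactDr !tassoc_auxD IHx IHy lactDr.
Qed.

Lemma tassoc_ract (x : tens M N) p u :
  tassoc_aux (ract p u) x = ract (tassoc_aux p x) u.
Proof.
elim/tens_ind: x => [m n|x y IHx IHy].
  by rewrite !tassoc_auxE !ract_pure.
by rewrite !tassoc_auxD IHx IHy ractDl.
Qed.

Definition tassoc : bihom (tens (tens M N) P) (tens M (tens N P)) :=
  tens_lift tassoc_balanced tassoc_lact tassoc_ract.

Lemma tassocE m n p : tassoc (pure (pure m n) p) = pure m (pure n p).
Proof. by rewrite tens_liftE tassoc_auxE. Qed.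

Definition tassocV_aux (m : M) : tens N P -> tens (tens M N) P :=
  tlift (fun n p => pure (pure m n) p).

Lemma tassocV_aux_balanced (m : M) :
  balanced (@ract _ _ _ N) (@lact _ _ _ P)
    (fun n p => pure (pure m n) p : tens (tens M N) P).
Proof.
split=> *; first by rewrite pureDr pureDl.
  exact: pureDr.
by rewrite -ract_pure pure_bal.
Qed.

Lemma tassocV_auxE m n p : tassocV_aux m (pure n p) = pure (pure m n) p.
Proof. exact: tliftE (tassocV_aux_balanced m). Qed.
Lemma tassocV_auxD m x y :
  tassocV_aux m (x + y) = tassocV_aux m x + tassocV_aux m y.
Proof. exact: tliftD (tassocV_aux_balanced m). Qed.

Lemma tassocV_balanced :
  balanced (@ract _ _ _ M) (@lact _ _ _ (tens N P)) tassocV_aux.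
Proof.
split=> [m m' x|m x y|m s x]; last 1 first.
- elim/tens_ind: x => [n p|x y IHx IHy].
    by rewrite lact_pure !tassocV_auxE pure_bal.
  by rewrite lactDr !tassocV_auxD IHx IHy.
- elim/tens_ind: x => [n p|x y IHx IHy]; first by rewrite !tassocV_auxE !pureDl.
  by rewrite !tassocV_auxD IHx IHy addrACA.
- exact: tassocV_auxD.
Qed.

Lemma tassocV_lact r m (x : tens N P) :
  tassocV_aux (lact r m) x = lact r (tassocV_aux m x).
Proof.
elim/tens_ind: x => [n p|x y IHx IHy].
  by rewrite !tassocV_auxE !lact_pure.
by rewrite !tassocV_auxD IHx IHy lactDr.
Qed.

Lemma tassocV_ract m (x : tens N P) u :
  tassocV_aux m (ract x u) = ract (tassocV_aux m x) u.
Proof.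
elim/tens_ind: x => [n p|x y IHx IHy].
  by rewrite ract_pure !tassocV_auxE ract_pure.
by rewrite ractDl !tassocV_auxD IHx IHy ractDl.
Qed.

Definition tassocV : bihom (tens M (tens N P)) (tens (tens M N) P) :=
  tens_lift tassocV_balanced tassocV_lact tassocV_ract.

Lemma tassocVE m n p : tassocV (pure m (pure n p)) = pure (pure m n) p.
Proof. by rewrite tens_liftE tassocV_auxE. Qed.

End Assoc.

Section Units.
Variables (R S : alg k) (M : bimod R S).

Lemma tunitl_balanced : balanced *%R (@lact k R S M) (@lact k R S M).
Proof. by split=> *; rewrite ?lactDl ?lactDr ?lactM. Qed.

Definition tunitl : bihom (tens (regular_bimod R) M) M :=
  @tens_lift k R R S (regular_bimod R) M M (@lact k R S M) tunitl_balanced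
    (@lactM k R S M) (fun r x s => esym (lractA r x s)).

Lemma tunitlE (r : R) (m : M) : tunitl (pure (r : regular_bimod R) m) = lact r m.
Proof. exact: tens_liftE. Qed.

Lemma tunitr_balanced : balanced (@ract k R S M) *%R (@ract k R S M).
Proof. by split=> *; rewrite ?ractDl ?ractDr ?ractM. Qed.

Definition tunitr : bihom (tens M (regular_bimod S)) M :=
  @tens_lift k R S S M (regular_bimod S) M (@ract k R S M) tunitr_balanced
    (@lractA k R S M) (@ractM k R S M).

Lemma tunitrE (m : M) (s : S) : tunitr (pure m (s : regular_bimod S)) = ract m s.
Proof. exact: tens_liftE. Qed.

End Units.

End TensorMaps.

Arguments tassoc {k R S T U M N P}.
Arguments tassocV {k R S T U M N P}.
Arguments tunitl {k R S M}.
Arguments tunitr {k R S M}.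

Record coring (k : comPzRingType) (A : alg k) (C : bimod A A) := Coring {
  comul : bihom C (tens C C);
  coeps : bihom C (regular_bimod A);
  comulA : forall c,
    tassoc (tmap comul (bid C) (comul c)) = tmap (bid C) comul (comul c);
  coepsl : forall c, tunitl (tmap coeps (bid C) (comul c)) = c;
  coepsr : forall c, tunitr (tmap (bid C) coeps (comul c)) = c
}.

(* Right comodules with a compatible left R-module structure, that is
   (R, C)-bicomodules. Plain right C-comodules are the case where R is the base
   algebra. *)
Record rcomod (k : comPzRingType) (R A : alg k) (C : bimod A A) (cC : coring C) :=
  Rcomod {
    rcar :> bimod R A;
    rcoact : bihom rcar (tens rcar C);
    rcoactA : forall x,
      tassoc (tmap rcoact (bid C) (rcoact x)) = tmap (bid rcar) (comul cC) (rcoact x);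
    rcoact_eps : forall x, tunitr (tmap (bid rcar) (coeps cC) (rcoact x)) = x
  }.

Record lcomod (k : comPzRingType) (A S : alg k) (C : bimod A A) (cC : coring C) :=
  Lcomod {
    lcar :> bimod A S;
    lcoact : bihom lcar (tens C lcar);
    lcoactA : forall x,
      tassoc (tmap (comul cC) (bid lcar) (lcoact x)) = tmap (bid C) lcoact (lcoact x);
    lcoact_eps : forall x, tunitl (tmap (coeps cC) (bid lcar) (lcoact x)) = x
  }.

Arguments rcomod {k} R {A C} cC.
Arguments lcomod {k A} S {C} cC.

Notation rcomodules cC := (rcomod (base_alg _) cC).
Notation lcomodules cC := (lcomod (base_alg _) cC).

Record rcomod_hom (k : comPzRingType) (R A : alg k) (C : bimod A A)
    (cC : coring C) (M N : rcomod R cC) := RcomodHom {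
  rhom :> bihom M N;
  rhom_colin : forall x, rcoact N (rhom x) = tmap rhom (bid C) (rcoact M x)
}.

Record lcomod_hom (k : comPzRingType) (A S : alg k) (C : bimod A A)
    (cC : coring C) (M N : lcomod S cC) := LcomodHom {
  lhom :> bihom M N;
  lhom_colin : forall x, lcoact N (lhom x) = tmap (bid C) lhom (lcoact M x)
}.

Section TmapLemmas.
Variable k : comPzRingType.

Lemma tmap_id (R S T : alg k) (M : bimod R S) (N : bimod S T) x :
  tmap (bid M) (bid N) x = x.
Proof.
by move: x; apply: tens_ext => *; rewrite ?bhomD ?tmapE.
Qed.

Lemma tmap_comp (R S T : alg k) (M M' M'' : bimod R S) (N N' N'' : bimod S T)
  (f : bihom M' M'') (g : bihom N' N'') (f' : bihom M M') (g' : bihom N N') x :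
  tmap f g (tmap f' g' x) = tmap (bcomp f f') (bcomp g g') x.
Proof.
by move: x; apply: tens_ext => *; rewrite ?bhomD ?tmapE.
Qed.

Lemma tmap_eq (R S T : alg k) (M M' : bimod R S) (N N' : bimod S T)
  (f f' : bihom M M') (g g' : bihom N N') x :
  (forall m, f m = f' m) -> (forall n, g n = g' n) -> tmap f g x = tmap f' g' x.
Proof.
by move=> ff gg; move: x; apply: tens_ext => *; rewrite ?bhomD ?tmapE ?ff ?gg.
Qed.

Lemma tassoc_nat (R S T U : alg k) (M M' : bimod R S) (N N' : bimod S T)
  (P P' : bimod T U) (f : bihom M M') (g : bihom N N') (h : bihom P P') x :
  tassoc (tmap (tmap f g) h x) = tmap f (tmap g h) (tassoc x).
Proof.
move: x; apply: tens_ext => [x y|x y|+ p]; rewrite ?bhomD //.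
by apply: tens_ind => [m n|x y IHx IHy];
  rewrite ?pureDl ?bhomD ?IHx ?IHy // !(tmapE, tassocE).
Qed.

Lemma tassocV_nat (R S T U : alg k) (M M' : bimod R S) (N N' : bimod S T)
  (P P' : bimod T U) (f : bihom M M') (g : bihom N N') (h : bihom P P') x :
  tassocV (tmap f (tmap g h) x) = tmap (tmap f g) h (tassocV x).
Proof.
move: x; apply: tens_ext => [x y|x y|m]; rewrite ?bhomD //.
by apply: tens_ind => [n p|x y IHx IHy];
  rewrite ?pureDr ?bhomD ?IHx ?IHy // !(tmapE, tassocVE).
Qed.

Lemma tassocK (R S T U : alg k) (M : bimod R S) (N : bimod S T) (P : bimod T U)
  (x : tens (tens M N) P) : tassocV (tassoc x) = x.
Proof.
move: x; apply: tens_ext => [x y|x y|+ p]; rewrite ?bhomD //.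
by apply: tens_ind => [m n|x y IHx IHy];
  rewrite ?pureDl ?bhomD ?IHx ?IHy // tassocE tassocVE.
Qed.

Lemma tassocVK (R S T U : alg k) (M : bimod R S) (N : bimod S T) (P : bimod T U)
  (x : tens M (tens N P)) : tassoc (tassocV x) = x.
Proof.
move: x; apply: tens_ext => [x y|x y|m]; rewrite ?bhomD //.
by apply: tens_ind => [n p|x y IHx IHy];
  rewrite ?pureDr ?bhomD ?IHx ?IHy // tassocVE tassocE.
Qed.

Lemma tpentagon (R S T U W : alg k) (M : bimod R S) (N : bimod S T)
  (P : bimod T U) (Q : bimod U W) (x : tens M (tens (tens N P) Q)) :
  tassoc (tmap (tassocV : bihom (tens M (tens N P)) _) (bid Q) (tassocV x)) =
  tassocV (tmap (bid M) tassoc x).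
Proof.
move: x; apply: tens_ext => [x y|x y|m]; rewrite ?bhomD //.
apply: tens_ind => [+ q|x y IHx IHy]; last by rewrite pureDr !bhomD IHx IHy.
apply: tens_ind => [n p|x y IHx IHy].
  by rewrite !(tmapE, tassocE, tassocVE).
by rewrite pureDl pureDr !bhomD IHx IHy.
Qed.

Lemma tpentagonV (R S T U W : alg k) (M : bimod R S) (N : bimod S T)
  (P : bimod T U) (Q : bimod U W) (x : tens M (tens N (tens P Q))) :
  tassocV (tassocV x) =
  tmap tassocV (bid Q) (tassocV (tmap (bid M) tassocV x)).
Proof.
elim/tens_ind: x => [m x|x y IHx IHy]; last by rewrite !bhomD IHx IHy.
elim/tens_ind: x => [n x|x y IHx IHy]; last by rewrite pureDr !bhomD IHx IHy.
elim/tens_ind: x => [p q|x y IHx IHy]; last by rewrite !pureDr !bhomD IHx IHy.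
by rewrite !(tmapE, tassocE, tassocVE).
Qed.

Lemma tpentagonR (R S T U W : alg k) (M : bimod R S) (N : bimod S T)
  (P : bimod T U) (Q : bimod U W) (x : tens (tens M N) (tens P Q)) :
  tmap tassoc (bid Q) (tassocV x) =
  tassocV (tmap (bid M) tassocV (tassoc x)).
Proof.
elim/tens_ind: x => [x z|x y IHx IHy]; last by rewrite !bhomD IHx IHy.
elim/tens_ind: x => [m n|x y IHx IHy]; last by rewrite pureDl !bhomD IHx IHy.
elim/tens_ind: z => [p q|x y IHx IHy]; last by rewrite !pureDr !bhomD IHx IHy.
by rewrite !(tmapE, tassocE, tassocVE).
Qed.

Lemma tunitl_assocV (R S T : alg k) (M : bimod R S) (N : bimod S T)
  (x : tens (regular_bimod R) (tens M N)) :
  tmap tunitl (bid N) (tassocV x) = tunitl x.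
Proof.
elim/tens_ind: x => [r x|x y IHx IHy]; last by rewrite !bhomD IHx IHy.
elim/tens_ind: x => [m n|x y IHx IHy]; last by rewrite pureDr !bhomD IHx IHy.
by rewrite tassocVE tmapE !tunitlE lact_pure.
Qed.

Lemma tunitl_nat (R S : alg k) (M N : bimod R S) (f : bihom M N)
  (x : tens (regular_bimod R) M) :
  tunitl (tmap (bid (regular_bimod R)) f x) = f (tunitl x).
Proof.
elim/tens_ind: x => [r m|x y IHx IHy]; last by rewrite !bhomD IHx IHy.
by rewrite tmapE !tunitlE bhoml.
Qed.

Lemma tunitr_assocV (R S T : alg k) (M : bimod R S) (N : bimod S T) x :
  tunitr (tassocV x : tens (tens M N) (regular_bimod T)) = tmap (bid M) tunitr x.
Proof.
move: x; apply: tens_ext => [x y|x y|m]; rewrite ?bhomD //.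
apply: tens_ind => [n s|x y IHx IHy]; last by rewrite pureDr !bhomD IHx IHy.
by rewrite tassocVE tunitrE tmapE tunitrE ract_pure.
Qed.

Lemma tmap_bid_tens (R S T U : alg k) (M : bimod R S) (N : bimod S T)
  (P P' : bimod T U) (f : bihom P P') (x : tens (tens M N) P) :
  tmap (bid (tens M N)) f x = tmap (tmap (bid M) (bid N)) f x.
Proof. by apply: tmap_eq => // y; rewrite tmap_id. Qed.

End TmapLemmas.

Section Comodules.
Variables (k : comPzRingType) (A : alg k) (C : bimod A A) (cC : coring C).

Lemma rcomod_hom_ext (R : alg k) (M N : rcomod R cC) (f g : rcomod_hom M N) :
  (forall x, f x = g x) -> f = g.
Proof.
case: f g => [f fc] [g gc] /= /bihom_ext fg; subst g.
by congr RcomodHom; apply: Prop_irrelevance.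
Qed.

Definition rcomod_id (R : alg k) (M : rcomod R cC) : rcomod_hom M M.
Proof. by exists (bid M) => x; rewrite tmap_id. Defined.

Definition rcomod_comp (R : alg k) (M N P : rcomod R cC)
  (g : rcomod_hom N P) (f : rcomod_hom M N) : rcomod_hom M P.
Proof.
exists (bcomp g f) => x.
by rewrite -[bcomp g f x]/(g (f x)) !rhom_colin tmap_comp; apply: tmap_eq.
Defined.

Section RcomodForgetLeft.
Variables (R : alg k) (M : rcomod R cC).

Definition forget_left_coact : bihom (forget_left M) (tens (forget_left M) C) :=
  @Bihom k _ _ (forget_left M) (tens (forget_left M) C) (rcoact M)
    (bhomD (rcoact M)) (fun c x => bhoml (rcoact M) (alg_str R c) x)
    (bhomr (rcoact M)).

Definition rcomod_forget_left : rcomodules cC :=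
  @Rcomod k _ A C cC (forget_left M) forget_left_coact
    (@rcoactA _ _ _ _ _ M) (@rcoact_eps _ _ _ _ _ M).

End RcomodForgetLeft.

Definition coring_rcomod : rcomod A cC := Rcomod (comulA cC) (coepsr cC).

Section TensRcomod.
Variables (R B : alg k) (V : bimod R B) (M : rcomod B cC).

Definition tens_coact : bihom (tens V M) (tens (tens V M) C) :=
  bcomp tassocV (tmap (bid V) (rcoact M)).

Lemma tens_coactA x :
  tassoc (tmap tens_coact (bid C) (tens_coact x)) =
  tmap (bid (tens V M)) (comul cC) (tens_coact x).
Proof.
have coactE y : tmap tens_coact (bid C) y
      = tmap tassocV (bid C) (tmap (tmap (bid V) (rcoact M)) (bid C) y).
  by rewrite tmap_comp; apply: tmap_eq.
rewrite coactE -[tens_coact x]/(tassocV (tmap _ _ x)).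
rewrite -tassocV_nat tpentagon tmap_bid_tens -tassocV_nat !tmap_comp.
by congr (tassocV _); apply: tmap_eq => // m; apply: rcoactA.
Qed.

Lemma tens_coact_eps x :
  tunitr (tmap (bid (tens V M)) (coeps cC) (tens_coact x)) = x.
Proof.
rewrite -[tens_coact x]/(tassocV (tmap _ _ x)).
rewrite tmap_bid_tens -tassocV_nat tunitr_assocV !tmap_comp -[RHS]tmap_id.
by apply: tmap_eq => // m; apply: rcoact_eps.
Qed.

Definition tens_rcomod : rcomod R cC := Rcomod tens_coactA tens_coact_eps.

End TensRcomod.

Definition tens_rcomod_hom (R B : alg k) (V W : bimod R B) (f : bihom V W)
  (M : rcomod B cC) : rcomod_hom (tens_rcomod V M) (tens_rcomod W M).
Proof.
exists (tmap f (bid M)) => x.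
rewrite -[rcoact _ _]/(tassocV (tmap (bid W) (rcoact M) (tmap f (bid M) x))).
rewrite -[rcoact _ _]/(tassocV (tmap (bid V) (rcoact M) x)).
rewrite -tassocV_nat !tmap_comp; congr (tassocV _).
by apply: tmap_eq => // m; rewrite -[RHS]/(tmap _ _ _) tmap_id.
Defined.

Definition cofree_rcomod (R : alg k) (N : bimod R A) : rcomod R cC :=
  tens_rcomod N coring_rcomod.

Section Cotensor.
Variables (R S : alg k) (M : rcomod R cC) (N : lcomod S cC).

Definition cotensor_pred : {pred tens M N} :=
  fun x => tmap (rcoact M) (bid N) x == tassocV (tmap (bid M) (lcoact N) x).

Record cotensor : Type := Cotensor {
  cotensor_val :> tens M N;
  cotensor_valP : cotensor_val \in cotensor_pred
}.

HB.instance Definition _ := [isSub for cotensor_val].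
HB.instance Definition _ := [Choice of cotensor by <:].

Lemma cotensor_pred_zmod : zmod_closed cotensor_pred.
Proof.
have bhom0 (V W : zmodType) (f : V -> W) : (forall x y, f (x + y) = f x + f y) ->
    f 0 = 0 /\ forall x y, f (x - y) = f x - f y.
  move=> fD; have f0 : f 0 = 0 by apply: (addrI (f 0)); rewrite -fD !addr0.
  split=> // x y; rewrite fD; congr (_ + _).
  by apply: (addrI (f y)); rewrite -fD !addrN.
have [a0 aB] := bhom0 _ _ _ (bhomD (tmap (rcoact M) (bid N))).
have [b0 bB] := bhom0 _ _ _ (bhomD (bcomp tassocV (tmap (bid M) (lcoact N)))).
split=> [|x y].
  by apply/eqP; rewrite a0 [RHS]b0.
move=> /eqP xE /eqP yE; apply/eqP; rewrite [LHS]aB [RHS]bB.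
by congr (_ - _).
Qed.

HB.instance Definition _ := GRing.isZmodClosed.Build _ cotensor_pred
  cotensor_pred_zmod.
HB.instance Definition _ := [SubChoice_isSubZmodule of cotensor by <:].

Lemma cotensorP x : reflect
  (tmap (rcoact M) (bid N) x = tassocV (tmap (bid M) (lcoact N) x))
  (x \in cotensor_pred).
Proof. exact: eqP. Qed.

Lemma cotensor_eq (x : cotensor) :
  tmap (rcoact M) (bid N) x = tassocV (tmap (bid M) (lcoact N) x).
Proof. exact/cotensorP/cotensor_valP. Qed.

Lemma cotensor_inj (x y : cotensor) : cotensor_val x = cotensor_val y -> x = y.
Proof. exact: val_inj. Qed.

Definition cotens_lact (r : R) (x : cotensor) : cotensor.
Proof.
exists (lact r (x : tens M N)); apply/cotensorP.
by rewrite !bhoml cotensor_eq.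
Defined.

Definition cotens_ract (x : cotensor) (s : S) : cotensor.
Proof.
exists (ract (x : tens M N) s); apply/cotensorP.
by rewrite !bhomr cotensor_eq.
Defined.

Definition cotens : bimod R S.
Proof.
exists cotensor cotens_lact cotens_ract; move=> *; apply: cotensor_inj.
- exact: lactDl.
- exact: lactDr.
- exact: lactM.
- exact: lact1.
- exact: ractDl.
- exact: ractDr.
- exact: ractM.
- exact: ract1.
- exact: lractA.
- exact: act_sym.
Defined.

Definition cotens_val : bihom cotens (tens M N) :=
  @Bihom k R S cotens (tens M N) cotensor_val (fun _ _ => erefl)
    (fun _ _ => erefl) (fun _ _ => erefl).

End Cotensor.

Section CotensMap.
Variables (R S : alg k) (M M' : rcomod R cC) (N N' : lcomod S cC).
Variables (f : rcomod_hom M M') (g : lcomod_hom N N').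

Lemma cotens_map_subproof (x : cotensor M N) : tmap f g x \in @cotensor_pred _ _ M' N'.
Proof.
apply/cotensorP; rewrite !tmap_comp.
transitivity (tmap (tmap f (bid C)) g (tmap (rcoact M) (bid N) x)).
  by rewrite tmap_comp; apply: tmap_eq => // m; apply: rhom_colin.
rewrite cotensor_eq -tassocV_nat tmap_comp; congr (tassocV _).
by apply: tmap_eq => // n; rewrite -[RHS]/(lcoact N' (g n)) lhom_colin.
Qed.

Definition cotens_map : bihom (cotens M N) (cotens M' N').
Proof.
exists (fun x => Cotensor (cotens_map_subproof x)).
- by move=> x y; apply: cotensor_inj; apply: (bhomD (tmap f g)).
- by move=> r x; apply: cotensor_inj; apply: (bhoml (tmap f g)).
- by move=> x s; apply: cotensor_inj; apply: (bhomr (tmap f g)).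
Defined.

End CotensMap.

Definition lcomod_id (S : alg k) (N : lcomod S cC) : lcomod_hom N N.
Proof. by exists (bid N) => x; rewrite tmap_id. Defined.

End Comodules.

Arguments coring_rcomod {k A C} cC.
Arguments cofree_rcomod {k A C} cC {R} N.
Arguments cotens_val {k A C cC R S M N}.

Record category := Category {
  obj :> Type;
  hom : obj -> obj -> Type;
  idm : forall X, hom X X;
  compm : forall X Y Z, hom Y Z -> hom X Y -> hom X Z;
  compm1 : forall X Y (f : hom X Y), compm f (idm X) = f;
  comp1m : forall X Y (f : hom X Y), compm (idm Y) f = f;
  compmA : forall X Y Z T (f : hom Z T) (g : hom Y Z) (h : hom X Y),
    compm f (compm g h) = compm (compm f g) h
}.

Arguments idm {c} X.
Arguments compm {c X Y Z}.

Record functor (CC DD : category) := Functor {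
  fobj :> CC -> DD;
  fmap : forall X Y, hom X Y -> hom (fobj X) (fobj Y);
  fmap1 : forall X, fmap (idm X) = idm (fobj X);
  fmapM : forall X Y Z (f : hom Y Z) (g : hom X Y),
    fmap (compm f g) = compm (fmap f) (fmap g)
}.

Arguments fmap {CC DD} F {X Y} : rename.

(* [adjunction F G]: F is left adjoint to G. *)
Record adjunction (CC DD : category) (F : functor CC DD) (G : functor DD CC) :=
  Adjunction {
    adj_unit : forall X, hom X (G (F X));
    adj_counit : forall Y, hom (F (G Y)) Y;
    adj_unit_nat : forall X X' (f : hom X X'),
      compm (adj_unit X') f = compm (fmap G (fmap F f)) (adj_unit X);
    adj_counit_nat : forall Y Y' (g : hom Y Y'),
      compm (adj_counit Y') (fmap F (fmap G g)) = compm g (adj_counit Y);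
    adj_triangle_l : forall X,
      compm (adj_counit (F X)) (fmap F (adj_unit X)) = idm (F X);
    adj_triangle_r : forall Y,
      compm (fmap G (adj_counit Y)) (adj_unit (G Y)) = idm (G Y)
  }.

Definition separable_functor (CC DD : category) (T : functor CC DD) : Prop :=
  exists P : forall X Y, hom (T X) (T Y) -> hom X Y,
    (forall X Y (f : hom X Y), P X Y (fmap T f) = f) /\
    (forall X X' Y Y' (u : hom X' X) (v : hom Y Y') (g : hom (T X) (T Y)),
       P X' Y' (compm (fmap T v) (compm g (fmap T u))) =
       compm v (compm (P X Y g) u)).

Definition Frobenius_functor (CC DD : category) (T : functor CC DD) : Prop :=
  exists G : functor DD CC,
    inhabited (adjunction T G) /\ inhabited (adjunction G T).

Section Transpose.
Variables (CC DD : category) (F : functor CC DD) (G : functor DD CC).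
Variable ad : adjunction F G.

Definition transpose X Y (f : hom X (G Y)) : hom (F X) Y :=
  compm (adj_counit ad Y) (fmap F f).

Lemma transposeK X Y (f : hom X (G Y)) :
  compm (fmap G (transpose f)) (adj_unit ad X) = f.
Proof.
rewrite fmapM -compmA -adj_unit_nat compmA adj_triangle_r.
exact: comp1m.
Qed.

Lemma adj_inj X Y (u v : hom (F X) Y) :
  compm (fmap G u) (adj_unit ad X) = compm (fmap G v) (adj_unit ad X) -> u = v.
Proof.
move=> uv; rewrite -[u]compm1 -[v]compm1 -(adj_triangle_l ad) !compmA.
by rewrite -!adj_counit_nat -!compmA -!fmapM uv.
Qed.

End Transpose.

Section Categories.
Variable k : comPzRingType.

Definition bimod_cat (R S : alg k) : category.
Proof.
exists (bimod R S) (@bihom k R S) (@bid k R S) (@bcomp k R S);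
  by move=> *; apply: bihom_ext.
Defined.

Variables (A : alg k) (C : bimod A A) (cC : coring C).

Definition rcomod_cat (R : alg k) : category.
Proof.
exists (rcomod R cC) (@rcomod_hom k R A C cC) (@rcomod_id _ _ _ _ R)
  (@rcomod_comp _ _ _ _ R); by move=> *; apply: rcomod_hom_ext.
Defined.

Definition forget_functor (R : alg k) : functor (rcomod_cat R) (bimod_cat R A) :=
  @Functor (rcomod_cat R) (bimod_cat R A) (fun M => rcar M)
    (fun M N f => rhom f) (fun M => erefl) (fun M N P f g => erefl).

Definition tens_functor (B : alg k) (L : rcomod B cC) :
  functor (bimod_cat (base_alg k) B) (rcomod_cat (base_alg k)).
Proof.
exists (fun V : bimod (base_alg k) B => tens_rcomod V L)
  (fun V W f => tens_rcomod_hom f L).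
- by move=> V; apply: rcomod_hom_ext => x; apply: tmap_id.
- move=> V W U f g; apply: rcomod_hom_ext => x.
  by rewrite [RHS]tmap_comp; apply: tmap_eq.
Defined.

Definition cotens_functor (B : alg k) (X : lcomod B cC) :
  functor (rcomod_cat (base_alg k)) (bimod_cat (base_alg k) B).
Proof.
exists (fun M : rcomod (base_alg k) cC => cotens M X)
  (fun M N f => cotens_map f (lcomod_id X)).
- by move=> M; apply: bihom_ext => x; apply: cotensor_inj; apply: tmap_id.
- move=> M N P f g; apply: bihom_ext => x; apply: cotensor_inj.
  by rewrite [RHS]tmap_comp; apply: tmap_eq.
Defined.

End Categories.

Definition exact_at (U V W : zmodType) (f : U -> V) (g : V -> W) : Prop :=
  forall y, g y = 0 <-> exists x, f x = y.

Section Properties.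
Variable k : comPzRingType.

Definition lflat (R S : alg k) (N : bimod R S) : Prop :=
  forall (M1 M2 M3 : rmod R) (f : bihom M1 M2) (g : bihom M2 M3),
    exact_at f g -> exact_at (tmap f (bid N)) (tmap g (bid N)).

Definition rflat (R S : alg k) (N : bimod R S) : Prop :=
  forall (M1 M2 M3 : lmod S) (f : bihom M1 M2) (g : bihom M2 M3),
    exact_at f g -> exact_at (tmap (bid N) f) (tmap (bid N) g).

Variables (A : alg k) (C : bimod A A) (cC : coring C).

Definition coflat (R : alg k) (M : rcomod R cC) : Prop :=
  forall (N1 N2 N3 : lcomodules cC) (f : lcomod_hom N1 N2) (g : lcomod_hom N2 N3),
    exact_at f g ->
    exact_at (cotens_map (rcomod_id M) f) (cotens_map (rcomod_id M) g).

Definition cosplit : Prop :=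
  exists s : bihom (regular_bimod A) C, forall a, coeps cC (s a) = a.

(* The two equations say that [p] is a map of C-bicomodules for the coactions
   C (x) comul and comul (x) C of C (x) C. *)
Definition coseparable : Prop :=
  exists p : bihom (tens C C) C,
    [/\ forall c, p (comul cC c) = c,
        forall z, comul cC (p z) =
          tmap p (bid C) (tassocV (tmap (bid C) (comul cC) z))
      & forall z, comul cC (p z) =
          tmap (bid C) p (tassoc (tmap (comul cC) (bid C) z))].

Definition Frobenius_coring : Prop :=
  Frobenius_functor (forget_functor cC (base_alg k)).

End Properties.

Section ScalarMaps.
Variable k : comPzRingType.

Definition badd (R S : alg k) (M N : bimod R S) (f g : bihom M N) : bihom M N.
Proof.
exists (fun x => f x + g x) => [x y|r x|x s].
- by rewrite !bhomD addrACA.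
- by rewrite !bhoml lactDr.
- by rewrite !bhomr ractDl.
Defined.

Lemma tmap_badd (R S T : alg k) (M M' : bimod R S) (N N' : bimod S T)
  (f f' : bihom M M') (g : bihom N N') x :
  tmap (badd f f') g x = tmap f g x + tmap f' g x.
Proof.
elim/tens_ind: x => [m n|x y IHx IHy]; first by rewrite !tmapE pureDl.
by rewrite bhomD IHx IHy (bhomD (tmap f g)) (bhomD (tmap f' g)) addrACA.
Qed.

Definition scal_hom (S : alg k) (M : rmod S) (c : k) : bihom M M.
Proof.
exists (lact (c : base_alg k)) => [x y|r x|x s].
- exact: lactDr.
- by rewrite -!lactM (mulrC c).
- exact/esym/lractA.
Defined.

Lemma tmap_scal (S T : alg k) (M : rmod S) (N : bimod S T) (c : k) x :
  tmap (scal_hom M c) (bid N) x = lact (c : base_alg k) x.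
Proof.
elim/tens_ind: x => [m n|x y IHx IHy]; first by rewrite tmapE lact_pure.
by rewrite bhomD lactDr IHx IHy.
Qed.

Lemma lmul_base (R S : alg k) (M : bimod R S) (r : R) (c : k) (x : M) :
  lact r (lact (alg_str R c) x) = lact (alg_str R c) (lact r x).
Proof. by rewrite -!lactM alg_central. Qed.

Definition lmul_hom (R S : alg k) (M : bimod R S) (r : R) :
    bihom (forget_left M) (forget_left M) :=
  @Bihom k _ S (forget_left M) (forget_left M) (@lact k R S M r)
    (fun x y => lactDr r x y) (fun c x => lmul_base r c x)
    (fun x s => esym (lractA r x s)).

Definition rcomod_lmul (R A : alg k) (C : bimod A A) (cC : coring C)
  (M : rcomod R cC) (r : R) :
  rcomod_hom (rcomod_forget_left M) (rcomod_forget_left M).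
Proof.
exists (lmul_hom M r : bihom (rcomod_forget_left M) (rcomod_forget_left M)).
exact: (fun x => bhoml (rcoact M) r x).
Defined.

End ScalarMaps.

Section Cohom.
Variables (k : comPzRingType) (A B : alg k) (C : bimod A A) (cC : coring C).
Variable L : rcomod B cC.

(* L is quasi-finite when this type is inhabited. *)
Record cohom := Cohom {
  cohom_functor :>
    functor (rcomod_cat cC (base_alg k)) (bimod_cat (base_alg k) B);
  cohom_adj : adjunction cohom_functor (tens_functor L)
}.

Variable h : cohom.

(* Exactness of sequences in the category of right C-comodules is exactness of
   the underlying modules, as it should be when C is flat as a left A-module. *)
Definition cohom_exact : Prop :=
  forall (M1 M2 M3 : rcomodules cC) (f : rcomod_hom M1 M2) (g : rcomod_hom M2 M3),
    exact_at f g ->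
    exact_at (fmap h f : bihom _ _) (fmap h g : bihom _ _).

Lemma cohom_ext (M : rcomodules cC) (V : rmod B) (u v : bihom (h M) V) :
  (forall m : M, tmap u (bid L) (rhom (adj_unit (cohom_adj h) M) m) =
     tmap v (bid L) (rhom (adj_unit (cohom_adj h) M) m)) -> u = v.
Proof.
by move=> uv; apply: (adj_inj (ad := cohom_adj h)); apply: rcomod_hom_ext.
Qed.

Lemma cohom_unit_nat (M N : rcomodules cC) (f : rcomod_hom M N) (m : M) :
  rhom (adj_unit (cohom_adj h) N) (f m) =
  tmap (fmap h f : bihom _ _) (bid L) (rhom (adj_unit (cohom_adj h) M) m).
Proof.
have e := adj_unit_nat (cohom_adj h) f.
exact: (congr1 (fun g : rcomod_hom _ _ => g m) e).
Qed.

Definition regular_rcomod : rcomodules cC := rcomod_forget_left (coring_rcomod cC).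

Definition theta : rcomod_hom regular_rcomod (tens_rcomod (h regular_rcomod) L) :=
  adj_unit (cohom_adj h) regular_rcomod.

Definition lmul_regular (a : A) : rcomod_hom regular_rcomod regular_rcomod :=
  rcomod_lmul (coring_rcomod cC) a.

Definition cohom_lact (a : A) : bihom (h regular_rcomod) (h regular_rcomod) :=
  fmap h (lmul_regular a).

Lemma theta_lmul (a : A) (c : C) :
  theta (lact a c) = tmap (cohom_lact a) (bid L) (theta c).
Proof. exact: (cohom_unit_nat (lmul_regular a) c). Qed.

Lemma cohom_lact_ext (a : A) (u : bihom (h regular_rcomod) (h regular_rcomod)) :
  (forall c : C, theta (lact a c) = tmap u (bid L) (theta c)) -> cohom_lact a = u.
Proof. by move=> ua; apply: cohom_ext => c; rewrite -ua -theta_lmul. Qed.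

Lemma cohom_lactDl a b x : cohom_lact (a + b) x = cohom_lact a x + cohom_lact b x.
Proof.
have -> : cohom_lact (a + b) = badd (cohom_lact a) (cohom_lact b).
  by apply: cohom_lact_ext => c; rewrite tmap_badd lactDl bhomD !theta_lmul.
by [].
Qed.

Lemma cohom_lactM a b x : cohom_lact (a * b) x = cohom_lact a (cohom_lact b x).
Proof.
have -> : cohom_lact (a * b) = bcomp (cohom_lact a) (cohom_lact b).
  apply: cohom_lact_ext => c; rewrite lactM !theta_lmul tmap_comp.
  exact: tmap_eq.
by [].
Qed.

Lemma cohom_lact1 x : cohom_lact 1 x = x.
Proof.
have -> : cohom_lact 1 = bid _.
  by apply: cohom_lact_ext => c; rewrite lact1 tmap_id.
by [].
Qed.

Lemma cohom_act_sym (c : k) x : cohom_lact (alg_str A c) x = ract x (alg_str B c).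
Proof.
have -> : cohom_lact (alg_str A c) = scal_hom (h regular_rcomod) c.
  apply: cohom_lact_ext => m; rewrite tmap_scal.
  exact: (bhoml theta (c : base_alg k) m).
exact: act_sym.
Qed.

(* X = h(C), with left A-action by functoriality. *)
Definition cohom_bimod : bimod A B :=
  @Bimod k A B (h regular_rcomod) (fun a => cohom_lact a)
    (@ract k _ B (h regular_rcomod)) cohom_lactDl (fun a => bhomD (cohom_lact a))
    cohom_lactM cohom_lact1 (@ractDl _ _ _ _) (@ractDr _ _ _ _) (@ractM _ _ _ _)
    (@ract1 _ _ _ _) (fun a x b => esym (bhomr (cohom_lact a) x b)) cohom_act_sym.

Definition theta_bihom : bihom C (tens cohom_bimod L) :=
  @Bihom k A A C (tens cohom_bimod L) theta (bhomD theta) theta_lmul (bhomr theta).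

(* C (x) C -> (C (x) X) (x) L, induced by theta on the second factor; it is a map
   of right C-comodules, hence corresponds to a map h(C (x) C) -> C (x) X, the
   canonical isomorphism. *)
Definition ctheta : bihom (tens C C) (tens (tens C cohom_bimod) L) :=
  bcomp tassocV (tmap (bid C) theta_bihom).

Lemma theta_colin (c : C) :
  tens_coact cohom_bimod L (theta_bihom c) = tmap theta_bihom (bid C) (comul cC c).
Proof. exact: (rhom_colin theta c). Qed.

Lemma ctheta_colin (z : tens C C) :
  tens_coact (tens C cohom_bimod) L (ctheta z) =
  tmap ctheta (bid C) (@tens_coact k A C cC A A C (coring_rcomod cC) z).
Proof.
rewrite -[LHS]/(tassocV (tmap _ _ (tassocV (tmap _ _ z)))).
rewrite -[@tens_coact k A C cC A A C (coring_rcomod cC) z]/(tassocV (tmap _ _ z)).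
rewrite tmap_bid_tens -tassocV_nat tpentagonV !tmap_comp.
have -> y : tmap ctheta (bid C) y =
    tmap tassocV (bid C) (tmap (tmap (bid C) theta_bihom) (bid C) y).
  by rewrite tmap_comp; apply: tmap_eq.
rewrite -tassocV_nat tmap_comp; congr (tmap _ _ (tassocV _)).
by apply: tmap_eq => // c; apply: theta_colin.
Qed.

Definition ctheta_rcomod_hom :
  rcomod_hom (rcomod_forget_left (cofree_rcomod cC C))
             (tens_rcomod (forget_left (tens C cohom_bimod)) L) :=
  @RcomodHom k _ _ _ cC (rcomod_forget_left (cofree_rcomod cC C))
    (tens_rcomod (forget_left (tens C cohom_bimod)) L)
    (@Bihom k _ _ (rcomod_forget_left (cofree_rcomod cC C))
       (tens_rcomod (forget_left (tens C cohom_bimod)) L) ctheta (bhomD ctheta)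
       (fun r x => bhoml ctheta (alg_str A r) x) (bhomr ctheta))
    ctheta_colin.

Lemma comul_colin (c : C) :
  @tens_coact k A C cC A A C (coring_rcomod cC) (comul cC c) =
  tmap (comul cC) (bid C) (comul cC c).
Proof. by rewrite -[LHS]/(tassocV (tmap _ _ _)) -comulA tassocK. Qed.

Definition comul_rcomod_hom :
  rcomod_hom regular_rcomod (rcomod_forget_left (cofree_rcomod cC C)) :=
  @RcomodHom k _ _ _ cC regular_rcomod (rcomod_forget_left (cofree_rcomod cC C))
    (@Bihom k _ _ regular_rcomod (rcomod_forget_left (cofree_rcomod cC C))
       (comul cC) (bhomD (comul cC)) (fun r x => bhoml (comul cC) (alg_str A r) x)
       (bhomr (comul cC)))
    comul_colin.

(* The canonical isomorphism h(C (x) C) -> C (x) X. *)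
Definition cohom_cofree :
    bihom (h (rcomod_forget_left (cofree_rcomod cC C)))
          (forget_left (tens C cohom_bimod)) :=
  transpose (cohom_adj h) (Y := forget_left (tens C cohom_bimod)) ctheta_rcomod_hom.

Definition cohom_coact_fun : bihom (h regular_rcomod) (forget_left (tens C cohom_bimod)) :=
  bcomp cohom_cofree (fmap h comul_rcomod_hom).

Lemma cohom_coact_theta (c : C) :
  tmap cohom_coact_fun (bid L) (theta c) = ctheta (comul cC c).
Proof.
transitivity (tmap cohom_cofree (bid L)
  (tmap (fmap h comul_rcomod_hom : bihom _ _) (bid L) (theta c))).
  by rewrite tmap_comp; apply: tmap_eq.
rewrite -[X in tmap cohom_cofree _ X](cohom_unit_nat comul_rcomod_hom c).
exact: (congr1 (fun g : rcomod_hom (rcomod_forget_left (cofree_rcomod cC C))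
    (tens_rcomod (forget_left (tens C cohom_bimod)) L) => g (comul cC c))
  (transposeK (cohom_adj h) (Y := forget_left (tens C cohom_bimod)) ctheta_rcomod_hom)).
Qed.

Lemma cohom_coact_lin (a : A) x :
  cohom_coact_fun (cohom_lact a x) = lact a (cohom_coact_fun x : tens C cohom_bimod).
Proof.
have -> : cohom_coact_fun (cohom_lact a x) =
    bcomp cohom_coact_fun (cohom_lact a) x by [].
have -> : bcomp cohom_coact_fun (cohom_lact a) =
    bcomp (lmul_hom (tens C cohom_bimod) a) cohom_coact_fun.
  apply: cohom_ext => c.
  transitivity (tmap cohom_coact_fun (bid L) (theta (lact a c))).
    by rewrite theta_lmul tmap_comp; apply: tmap_eq.
  rewrite cohom_coact_theta !bhoml -cohom_coact_theta.
  transitivity (tmap (lmul_hom (tens C cohom_bimod) a) (bid L)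
    (tmap cohom_coact_fun (bid L) (theta c))); first by [].
  by rewrite tmap_comp; apply: tmap_eq.
by [].
Qed.

(* The left coaction h(comul) of X. *)
Definition cohom_coact : bihom cohom_bimod (tens C cohom_bimod) :=
  @Bihom k A B cohom_bimod (tens C cohom_bimod) cohom_coact_fun
    (bhomD cohom_coact_fun) cohom_coact_lin (bhomr cohom_coact_fun).

Lemma cohom_bimod_ext (V : bimod A B) (u v : bihom cohom_bimod V) :
  (forall c, tmap u (bid L) (theta_bihom c) = tmap v (bid L) (theta_bihom c)) ->
  forall x, u x = v x.
Proof.
have forget_lin (w : bihom cohom_bimod V) (r : k) (x : h regular_rcomod) :
    w (lact (r : base_alg k) x) = lact (alg_str A r) (w x).
  by rewrite act_sym -bhomr; congr (w _);
  apply: (@act_sym k (base_alg k) B (h regular_rcomod) r x).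
pose forget (w : bihom cohom_bimod V) := @Bihom k _ B (h regular_rcomod) (forget_left V) w (bhomD w)
  (forget_lin w) (bhomr w).
move=> uv x.
have /(congr1 (fun f : bihom (h regular_rcomod) (forget_left V) => f x)) :
  forget u = forget v by apply: cohom_ext => c; apply: uv.
by [].
Qed.

Lemma cohom_coactA x :
  tassoc (tmap (comul cC) (bid cohom_bimod) (cohom_coact x)) =
  tmap (bid C) cohom_coact (cohom_coact x).
Proof.
apply: (@cohom_bimod_ext _
  (bcomp tassoc (bcomp (tmap (comul cC) (bid cohom_bimod)) cohom_coact))
  (bcomp (tmap (bid C) cohom_coact) cohom_coact)) => c.
have coactE d : tmap cohom_coact (bid L) (theta_bihom d) = ctheta (comul cC d).
  exact: cohom_coact_theta.
transitivity (tmap tassoc (bid L)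
    (tmap (tmap (comul cC) (bid cohom_bimod)) (bid L) (ctheta (comul cC c)))).
  by rewrite -coactE !tmap_comp; apply: tmap_eq.
transitivity (tmap (tmap (bid C) cohom_coact) (bid L) (ctheta (comul cC c)));
  last by rewrite -coactE !tmap_comp; apply: tmap_eq.
rewrite -[ctheta _]/(tassocV (tmap _ _ _)) -!tassocV_nat tpentagonR.
congr (tassocV _).
transitivity (tmap (bid C) tassocV (tassoc (tmap (tmap (bid C) (bid C)) theta_bihom
    (tmap (comul cC) (bid C) (comul cC c))))).
  congr (tmap _ _ (tassoc _)); rewrite !tmap_comp.
  by apply: tmap_eq => d; rewrite ?[LHS]tmap_id ?[RHS]tmap_id.
rewrite tassoc_nat comulA !tmap_comp; apply: tmap_eq => // d.
by rewrite -[RHS]/(tmap _ _ (theta_bihom d)) coactE.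
Qed.

Lemma cohom_coact_eps x :
  tunitl (tmap (coeps cC) (bid cohom_bimod) (cohom_coact x)) = x.
Proof.
apply: (@cohom_bimod_ext _
  (bcomp tunitl (bcomp (tmap (coeps cC) (bid cohom_bimod)) cohom_coact))
  (bid cohom_bimod)) => c.
transitivity (tmap tunitl (bid L)
    (tmap (tmap (coeps cC) (bid cohom_bimod)) (bid L)
       (tmap cohom_coact (bid L) (theta_bihom c)))).
  by rewrite !tmap_comp; apply: tmap_eq.
rewrite [X in tmap _ _ (tmap _ _ X)]cohom_coact_theta.
rewrite -[ctheta _]/(tassocV (tmap _ _ _)) -tassocV_nat tunitl_assocV tmap_id.
transitivity (tunitl (tmap (bid (regular_bimod A)) theta_bihom
    (tmap (coeps cC) (bid C) (comul cC c)))).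
  congr (tunitl _); rewrite !tmap_comp; apply: tmap_eq => // d.
  by rewrite -[LHS]/(tmap _ _ _) tmap_id.
by rewrite tunitl_nat coepsl.
Qed.

Definition cohom_lcomod : lcomod B cC := Lcomod cohom_coactA cohom_coact_eps.

End Cohom.

Section Comatrix.
Variables (k : comPzRingType) (A B : alg k) (C : bimod A A) (cC : coring C).
Variables (L : rcomod B cC) (h : cohom L).

Local Notation X := (cohom_lcomod h).

(* L (x) X -> L (x) C (x) X -> L (x) (X (x) L) (x) X, namely L (x) lambda followed
   by L (x) theta (x) X, rebracketed. On L [] X the first map is the isomorphism
   with L [] C [] X, so the composite is L [] theta [] X. *)
Definition comatrix_map : bihom (tens L X) (tens (tens L X) (tens L X)) :=
  bcomp tassocV (bcomp (tmap (bid L) tassoc)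
    (bcomp (tmap (bid L) (tmap (theta_bihom h) (bid X)))
      (tmap (bid L) (lcoact X)))).

Section TensCotens.
Variable V : rmod B.

Lemma tens_cotens_subproof (w : tens V (cotens L X)) :
  (tassocV (tmap (bid V) cotens_val w) : tens (tens V L) X)
    \in @cotensor_pred _ _ _ _ _ _ (tens_rcomod V L) X.
Proof.
set y := tmap (bid V) cotens_val w.
apply/cotensorP.
have -> : tmap (rcoact (tens_rcomod V L)) (bid X) (tassocV y) =
    tmap tassocV (bid X) (tmap (tmap (bid V) (rcoact L)) (bid X) (tassocV y)).
  by rewrite tmap_comp; apply: tmap_eq.
rewrite -tassocV_nat.
have -> : tmap (bid V) (tmap (rcoact L) (bid X)) y =
    tmap (bid V) tassocV (tmap (bid V) (tmap (bid L) (lcoact X)) y).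
  by rewrite !tmap_comp; apply: tmap_eq => // z; apply: cotensor_eq.
by rewrite -tpentagonV tassocV_nat -tmap_bid_tens.
Qed.

(* The canonical map V (x) (L [] X) -> (V (x) L) [] X. *)
Definition tens_cotens : bihom (tens V (cotens L X)) (cotens (tens_rcomod V L) X).
Proof.
pose f := bcomp tassocV (tmap (bid V) cotens_val) : bihom _ (tens (tens V L) X).
exists (fun w => Cotensor (tens_cotens_subproof w)).
- by abstract (move=> x y; apply: cotensor_inj; apply: (bhomD f)).
- by abstract (move=> r x; apply: cotensor_inj; apply: (bhoml f)).
- by abstract (move=> x s; apply: cotensor_inj; apply: (bhomr f)).
Defined.

End TensCotens.

(* The coring structure [E] on L [] X is that of the comatrix coring: its coproduct
   is L [] theta [] X (compared inside (L (x) X) (x) (L (x) X)), and -[]X is left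
   adjoint to -(x)L, with unit M = M [] C -> M [] X (x) L given by theta and counit
   V (x) coeps. *)
Definition is_comatrix_coring (E : coring (cotens L X)) : Prop :=
  (forall z, tmap cotens_val cotens_val (comul E z) = comatrix_map (cotens_val z)) /\
  exists ad : adjunction (cotens_functor X) (tens_functor L),
    (forall (M : rcomodules cC) (m : M),
       tmap (cotens_val : bihom (cotens M X) (tens M X)) (bid L)
         (rhom (adj_unit ad M) m) =
       tassocV (tmap (bid M) (theta_bihom h) (rcoact M m))) /\
    (forall (V : rmod B) (w : tens V (cotens L X)),
       (adj_counit ad V : bihom _ _) (tens_cotens V w) =
       tunitr (tmap (bid V) (coeps E) w)).

Section UnitElt.

Local Notation Bk := (forget_left (regular_bimod B)).

Definition unit_bihom : bihom (tens_rcomod Bk L) (rcomod_forget_left L) :=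
  @Bihom k _ _ (tens_rcomod Bk L) (rcomod_forget_left L)
    (@tunitl k B A L) (bhomD tunitl) (fun c w => bhoml tunitl (alg_str B c) w)
    (bhomr tunitl).

Lemma unit_colin (w : tens (regular_bimod B) L) :
  rcoact L (tunitl w) = tmap tunitl (bid C) (tens_coact (regular_bimod B) L w).
Proof.
by rewrite -[tens_coact _ _ w]/(tassocV (tmap _ _ w)) tunitl_assocV tunitl_nat.
Qed.

Definition unit_rcomod_hom :
    rcomod_hom (tens_rcomod Bk L) (rcomod_forget_left L) :=
  @RcomodHom k _ _ _ cC (tens_rcomod Bk L) (rcomod_forget_left L) unit_bihom
    unit_colin.

Lemma cotens_forget_subproof (z : cotensor (rcomod_forget_left L) X) :
  (z : tens L X) \in @cotensor_pred _ _ _ _ _ _ L X.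
Proof. exact/cotensorP/(cotensor_eq z). Qed.

Definition cotens_forget (z : cotens (rcomod_forget_left L) X) : cotens L X :=
  Cotensor (cotens_forget_subproof z).

(* xi_B(1) as an element of L [] X = (B (x) L) [] X. *)
Definition unit_elt (xi : adjunction (tens_functor L) (cotens_functor X)) :
    cotens L X :=
  cotens_forget (cotens_map unit_rcomod_hom (lcomod_id X)
    ((adj_unit xi Bk : bihom _ _) (1 : B))).

End UnitElt.

End Comatrix.

(* For a B-coring E and e in E, the map f |-> (f (x) E)(comul e) on the right dual. *)
Definition dual_map (k : comPzRingType) (B : alg k) (E : bimod B B) (cE : coring E)
    (e : E) (f : bihom (forget_left E) (forget_left (regular_bimod B))) : E :=
  tunitl (tmap f (bid E) (comul cE e) : tens (regular_bimod B) E).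

(* Main.v *)
From HB Require Import structures.
From mathcomp Require Import all_boot all_algebra boolp.
Require Import Defs.

Set Implicit Arguments.
Unset Strict Implicit.
Unset Printing Implicit Defensive.

Import GRing.Theory.
Local Open Scope ring_scope.

(* Write T = - (x)_B L, G = - [] X and E = L [] X. Since h(W (x)_A C) = W (x)_A X for
   every right A-module W, the coaction M -> M (x) C induces h(M) -> M [] X; it is
   bijective because M -> M (x) C => M (x) C (x) C remains exact under h when h is exact,
   and is split when C is coseparable. Hence G is left adjoint to T, and V (x)_B E -> G T V
   is invertible for every right B-module V, so that E is the coring of the comonad
   G T. Part (1) is Rafael's criterion for the counit of this adjunction. For (2) and (3),
   any natural transformation n : T G -> 1 induces G n T : G T G T -> G T, that is a
   bimodule map E (x) E -> E, which naturality makes E-bicolinear. When n splits the unit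
   this is a splitting of the coproduct; when n is the counit of T -| G it is the
   multiplication of a Frobenius monad with unit xi_B(1). *)

(** * Adjoint functors and bimodules *)

(** The obstacle is that the coproduct of the comatrix coring is specified only inside (L (x) X) (x)
    (L (x) X), whereas the computations use its description as G eta_L under E (x) E = G(E (x) L).
    Passing from the former to the latter requires G T to keep the inclusion E -> L (x) X injective
    ([cotens_incl_mono]). With h exact this holds because T, a right adjoint, preserves
    monomorphisms, and left flatness of C makes those of M^C injective; with C coseparable the
    inclusion splits over B on the right, so that every functor preserves it. A second point is that
    h, T and G only see right B-modules, while E is a bimodule. Left multiplications by b are
    however morphisms of L and of B in these categories, and left linearity mostly comes from
    naturality along them. Likewise each v (x) - is a morphism, and naturality along these
    determines the components at V (x) L from the component at L. *)

Section Adjunctions.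
Variables (CC DD : category) (F F' : functor CC DD) (G : functor DD CC).
Variable ad : adjunction F G.

(** Meant for the isomorphism from h(M) to M [] X. The unit is recorded because the definition of
    the comatrix coring prescribes it. *)
Lemma adjunction_transfer (u : forall M, hom (F M) (F' M)) (v : forall M, hom (F' M) (F M)) :
  (forall M N (f : hom M N), compm (u N) (fmap F f) = compm (fmap F' f) (u M)) ->
  (forall M, compm (u M) (v M) = idm _) -> (forall M, compm (v M) (u M) = idm _) ->
  {ad' : adjunction F' G | forall M, adj_unit ad' M = compm (fmap G (u M)) (adj_unit ad M)}.
Proof.
move=> u_nat uv vu.
have v_nat M N (f : hom M N) : compm (v N) (fmap F' f) = compm (fmap F f) (v M).
  rewrite -[LHS]compm1 -(uv M) !compmA -(compmA (v N)) -u_nat compmA vu.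
  by rewrite comp1m.
unshelve eexists.
  exists (fun M => compm (fmap G (u M)) (adj_unit ad M))
         (fun V => compm (adj_counit ad V) (v (G V))).
  - move=> M N f; rewrite -compmA adj_unit_nat !compmA -!fmapM.
    by rewrite u_nat.
  - move=> V W g; rewrite -compmA v_nat compmA adj_counit_nat compmA //.
  - move=> M; rewrite fmapM -compmA (compmA (v _)) v_nat -compmA v_nat.
    rewrite !compmA adj_counit_nat -(compmA (u M)) adj_triangle_l compm1; exact: uv.
  - move=> V; rewrite fmapM -compmA (compmA (fmap G (v _))) -fmapM vu fmap1 comp1m.
    exact: adj_triangle_r.
by [].
Defined.

Lemma right_adjoint_mono V W (f : hom V W) :
  (forall M (u v : hom M V), compm f u = compm f v -> u = v) ->
  forall M (u v : hom M (G V)), compm (fmap G f) u = compm (fmap G f) v -> u = v.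
Proof.
move=> f_mono M u v uv; rewrite -(transposeK ad u) -(transposeK ad v).
congr (compm (fmap G _) _); apply: f_mono; apply: (adj_inj (ad := ad)).
by rewrite (fmapM G f (transpose ad u)) (fmapM G f (transpose ad v)) -!compmA !transposeK.
Qed.

(** Rafael's criterion: [P] applied to the counit at F M retracts the unit at M. The second left
    adjoint [F'] is present because separability is assumed of h while the unit of - [] X is to be
    retracted; the comparison [a] carries one unit to the other. *)
Lemma separable_left_adjoint (ad' : adjunction F' G) : separable_functor F ->
  exists n : forall M, hom (G (F' M)) M,
    (forall M N (f : hom M N), compm f (n M) = compm (n N) (fmap G (fmap F' f))) /\
    forall M, compm (n M) (adj_unit ad' M) = idm M.
Proof.
case=> P [Pf Pnat].
have [a aK] : exists a : forall M, hom (F' M) (F M),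
    forall M, compm (fmap G (a M)) (adj_unit ad' M) = adj_unit ad M.
  by exists (fun M => transpose ad' (adj_unit ad M)) => M; apply: transposeK.
have Pl M N N' (v : hom N N') (g : hom (F M) (F N)) :
    P M N' (compm (fmap F v) g) = compm v (P M N g).
  by rewrite -[g]compm1 -[in LHS]fmap1 Pnat !compm1.
have Pr M M' N (v : hom M' M) (g : hom (F M) (F N)) :
    P M' N (compm g (fmap F v)) = compm (P M N g) v.
  by rewrite -[compm g _]comp1m -[in LHS]fmap1 Pnat !comp1m.
exists (fun M => compm (P _ _ (adj_counit ad (F M))) (fmap G (a M))); split=> [M N f|M].
  rewrite compmA -Pl -adj_counit_nat Pr -!compmA -!fmapM; congr (compm _ (fmap G _)).
  apply: (adj_inj (ad := ad')); rewrite !fmapM -!compmA -adj_unit_nat aK.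
  by rewrite compmA aK adj_unit_nat.
by rewrite -compmA aK -Pr adj_triangle_l -(Pf _ _ (idm M)) fmap1.
Qed.

End Adjunctions.

Section BimodLemmas.
Variables (k : comPzRingType) (R S : alg k).

Lemma bhom0 (M N : bimod R S) (f : bihom M N) : f 0 = 0.
Proof. by apply: (addrI (f 0)); rewrite -bhomD !addr0. Qed.

Lemma bhomN (M N : bimod R S) (f : bihom M N) x : f (- x) = - f x.
Proof. by apply: (addrI (f x)); rewrite -bhomD !addrN bhom0. Qed.

Lemma bhomB (M N : bimod R S) (f : bihom M N) x y : f (x - y) = f x - f y.
Proof. by rewrite bhomD bhomN. Qed.

Lemma bhom_inj (M N : bimod R S) (f : bihom M N) :
  (forall x, f x = 0 -> x = 0) -> injective f.
Proof.
by move=> f0 x y fxy; apply/eqP; rewrite -subr_eq0; apply/eqP/f0; rewrite bhomB fxy subrr.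
Qed.

Lemma lact0 (M : bimod R S) r : lact r (0 : M) = 0.
Proof. by apply: (addrI (lact r (0 : M))); rewrite -lactDr !addr0. Qed.
Lemma lactN (M : bimod R S) r (x : M) : lact r (- x) = - lact r x.
Proof. by apply: (addrI (lact r x)); rewrite -lactDr !addrN lact0. Qed.
Lemma ract0 (M : bimod R S) s : ract (0 : M) s = 0.
Proof. by apply: (addrI (ract (0 : M) s)); rewrite -ractDl !addr0. Qed.
Lemma ractN (M : bimod R S) (x : M) s : ract (- x) s = - ract x s.
Proof. by apply: (addrI (ract x s)); rewrite -ractDl !addrN ract0. Qed.

Definition bzero (M N : bimod R S) : bihom M N.
Proof.
exists (fun _ => 0) => [_ _|r _|_ s]; by rewrite ?addr0 ?lact0 ?ract0.
Defined.

Definition bsub (M N : bimod R S) (f g : bihom M N) : bihom M N.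
Proof.
exists (fun x => f x - g x) => [x y|r x|x s].
- by rewrite !bhomD opprD addrACA.
- by rewrite !bhoml lactDr lactN.
- by rewrite !bhomr ractDl ractN.
Defined.

(** Preimages are chosen pointwise; injectivity of [i] makes them unique, and uniqueness makes the
    choice linear. *)
Lemma bfactor (K M N : bimod R S) (i : bihom K M) (g : bihom N M) :
  injective i -> (forall x, exists y, i y = g x) -> {g' : bihom N K | forall x, i (g' x) = g x}.
Proof.
move=> iI gi; pose g' x := sval (cid (gi x)).
have g'E x : i (g' x) = g x by apply: (svalP (cid (gi x))).
have gD x y : g' (x + y) = g' x + g' y by apply: iI; rewrite bhomD !g'E bhomD.
have gl r x : g' (lact r x) = lact r (g' x) by apply: iI; rewrite bhoml !g'E bhoml.
have gr x s : g' (ract x s) = ract (g' x) s by apply: iI; rewrite bhomr !g'E bhomr.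
by exists (Bihom gD gl gr).
Qed.

Lemma binverse (M N : bimod R S) (f : bihom M N) :
  injective f -> (forall y, exists x, f x = y) ->
  {g : bihom N M | cancel f g & cancel g f}.
Proof.
by move=> fI fS; have [g gE] := bfactor (g := bid N) fI fS; exists g => x //; apply: fI;
  apply: gE.
Qed.

(** Flatness and exactness of h speak of three-term sequences, so injectivity is put in that form.
    The zero map starts at M itself, which avoids introducing a zero module. *)
Lemma exact_zero_inj (M N : bimod R S) (f : bihom M N) :
  exact_at (bzero M M) f <-> injective f.
Proof.
split=> [fE|fI y].
  by apply: bhom_inj => x /fE[].
split=> [fy|[x <-]]; last exact: bhom0.
by exists 0; apply: fI; rewrite fy; apply: bhom0.
Qed.

Lemma tmap_bsub (T : alg k) (M M' : bimod R S) (N N' : bimod S T)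
  (f f' : bihom M M') (g : bihom N N') x :
  tmap (bsub f f') g x = tmap f g x - tmap f' g x.
Proof.
have -> : tmap f g x = tmap (badd (bsub f f') f') g x.
  by apply: tmap_eq => // m; rewrite /= subrK.
by rewrite tmap_badd addrK.
Qed.

Lemma tmap_bzero (T : alg k) (M M' : bimod R S) (N N' : bimod S T) (g : bihom N N') x :
  tmap (bzero M M') g x = 0.
Proof.
elim/tens_ind: x => [m n|x y IHx IHy]; first by rewrite tmapE; apply: tpure0.
by rewrite bhomD IHx IHy addr0.
Qed.

(** * Kernels of bimodule maps *)

Section Kernel.
Variables (M N : bimod R S) (f : bihom M N).

Definition ker_pred : {pred M} := fun x => f x == 0.
Record ker : Type := Ker { ker_val :> M; ker_valP : ker_val \in ker_pred }.
HB.instance Definition _ := [isSub for ker_val].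
HB.instance Definition _ := [Choice of ker by <:].

Lemma ker_pred_zmod : zmod_closed ker_pred.
Proof.
split=> [|x y /eqP fx /eqP fy]; apply/eqP; first exact: bhom0.
by rewrite bhomB fx fy subr0.
Qed.
HB.instance Definition _ := GRing.isZmodClosed.Build _ ker_pred ker_pred_zmod.
HB.instance Definition _ := [SubChoice_isSubZmodule of ker by <:].

Lemma ker_eq0 (x : ker) : f x = 0.
Proof. exact/eqP/(ker_valP x). Qed.

Lemma ker_inj (x y : ker) : ker_val x = ker_val y -> x = y.
Proof. exact: val_inj. Qed.

Definition ker_lact (r : R) (x : ker) : ker.
Proof. by exists (lact r (x : M)); apply/eqP; rewrite bhoml ker_eq0 lact0. Defined.

Definition ker_ract (x : ker) (s : S) : ker.
Proof. by exists (ract (x : M) s); apply/eqP; rewrite bhomr ker_eq0 ract0. Defined.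

Definition bker : bimod R S.
Proof.
exists ker ker_lact ker_ract; move=> *; apply: ker_inj.
- exact: lactDl.
- exact: lactDr.
- exact: lactM.
- exact: lact1.
- exact: ractDl.
- exact: ractDr.
- exact: ractM.
- exact: ract1.
- exact: lractA.
- exact: act_sym.
Defined.

Definition bker_val : bihom bker M :=
  @Bihom k R S bker M ker_val (fun _ _ => erefl) (fun _ _ => erefl) (fun _ _ => erefl).

Lemma bker_val_inj : injective bker_val.
Proof. exact: ker_inj. Qed.

Lemma bker_exact : exact_at bker_val f.
Proof.
move=> y; split=> [fy|[x <-]]; last exact: ker_eq0.
by exists (@Ker y (introT eqP fy)).
Qed.

End Kernel.
End BimodLemmas.

(** * The cohom functor on cofree comodules *)

Section Insertion.
Variables (k : comPzRingType) (A B : alg k) (C : bimod A A) (cC : coring C).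

Lemma base_act (S : alg k) (W : rmod S) (c : k) (w : W) :
  ract w (alg_str S c) = lact (c : base_alg k) w.
Proof. by rewrite -act_sym. Qed.

(** The insertion is not S-linear on the left, hence the restriction of N to k. Insertions are
    morphisms to which naturality applies, and their images generate W (x) N. *)
Definition tins (S T : alg k) (W : rmod S) (N : bimod S T) (w : W) :
  bihom (forget_left N) (tens W N).
Proof.
exists (fun n => pure w n) => [x y|c x|x s].
- exact: pureDr.
- by rewrite [RHS]lact_pure -(base_act c w); apply: esym (pure_bal _ _ _).
- by rewrite ract_pure.
Defined.

Lemma tins_assocV (S T U : alg k) (W : rmod S) (N : bimod S T) (P : bimod T U) (w : W)
  (y : tens N P) : tassocV (pure w y) = tmap (tins N w) (bid P) y :> tens (tens W N) P.
Proof.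
elim/tens_ind: y => [n p|x y IHx IHy]; first by rewrite tassocVE [RHS]tmapE.
by rewrite pureDr bhomD IHx IHy [RHS](bhomD (tmap (tins N w) (bid P))).
Qed.

Definition rins (S : alg k) (W : rmod S) (M : rcomod S cC) (w : W) :
  rcomod_hom (rcomod_forget_left M) (tens_rcomod W M).
Proof.
exists (tins M w : bihom (rcomod_forget_left M) (tens_rcomod W M)) => m.
rewrite -[LHS]/(tassocV (tmap (bid W) (rcoact M) (pure w m))) tmapE tins_assocV.
exact: tmap_eq.
Defined.

Definition coact_hom (M : rcomodules cC) : rcomod_hom M (cofree_rcomod cC M).
Proof.
exists (rcoact M) => m.
by rewrite -[LHS]/(tassocV (tmap _ _ _)) -rcoactA tassocK.
Defined.

Definition cofree_hom (W V : rmod A) (f : bihom W V) :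
  rcomod_hom (cofree_rcomod cC W) (cofree_rcomod cC V) := tens_rcomod_hom f (coring_rcomod cC).

Lemma coact_hom_nat (M N : rcomodules cC) (f : rcomod_hom M N) :
  rcomod_comp (cofree_hom f) (coact_hom M) = rcomod_comp (coact_hom N) f.
Proof. by apply: rcomod_hom_ext => m; rewrite -[RHS]/(rcoact N (f m)) rhom_colin. Qed.

Definition rcomod_zero (R : alg k) (M N : rcomod R cC) : rcomod_hom M N.
Proof. by exists (bzero M N) => x; rewrite tmap_bzero [LHS]bhom0. Defined.

Definition rcomod_sub (R : alg k) (M N : rcomod R cC) (f g : rcomod_hom M N) : rcomod_hom M N.
Proof. by exists (bsub f g) => x; rewrite tmap_bsub -!rhom_colin [LHS]bhomB. Defined.

End Insertion.

Section CohomCotensor.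
Variables (k : comPzRingType) (A B : alg k) (C : bimod A A) (cC : coring C).
Variables (L : rcomod B cC) (h : cohom L).
Local Notation X := (cohom_lcomod h).
Local Notation eta := (adj_unit (cohom_adj h)).

Lemma cohom_extP (M : rcomodules cC) (V : rmod B) (u v : bihom (h M) V) :
  (forall m : M, tmap u (bid L) (rhom (eta M) m) = tmap v (bid L) (rhom (eta M) m)) ->
  forall x, u x = v x.
Proof. by move/cohom_ext->. Qed.

Lemma cohom_eq (M N : rcomodules cC) (f g : rcomod_hom M N) :
  (forall m, f m = g m) -> fmap h f = fmap h g.
Proof. by move/rcomod_hom_ext->. Qed.

Lemma cohom_comp (M N P : rcomodules cC) (f : rcomod_hom N P) (g : rcomod_hom M N) x :
  (fmap h (rcomod_comp f g) : bihom _ _) x =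
  (fmap h f : bihom _ _) ((fmap h g : bihom _ _) x).
Proof. exact: (congr1 (fun u : bihom (h M) (h P) => u x) (fmapM h f g)). Qed.

Lemma cohom_id (M : rcomodules cC) (f : rcomod_hom M M) x :
  (forall m, f m = m) -> (fmap h f : bihom _ _) x = x.
Proof.
move=> f1; rewrite (_ : f = rcomod_id M); last exact: rcomod_hom_ext.
exact: (congr1 (fun u : bihom (h M) (h M) => u x) (fmap1 h M)).
Qed.

(** As a left adjoint, h is additive: both sides have the same transpose. The sum is a separate
    variable [s] so that it can be an insertion at w + w'. *)
Lemma cohom_hom_add (M N : rcomodules cC) (f g s : rcomod_hom M N) :
  (forall m, s m = f m + g m) ->
  forall x, (fmap h s : bihom _ _) x = (fmap h f : bihom _ _) x + (fmap h g : bihom _ _) x.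
Proof.
move=> sE; apply: (@cohom_extP _ _ _ (badd (fmap h f) (fmap h g))) => m.
by rewrite tmap_badd -!cohom_unit_nat sE bhomD.
Qed.

Lemma cohom_hom_sub (M N : rcomodules cC) (f g : rcomod_hom M N) x :
  (fmap h (rcomod_sub f g) : bihom _ _) x = (fmap h f : bihom _ _) x - (fmap h g : bihom _ _) x.
Proof.
apply/eqP; rewrite eq_sym subr_eq; apply/eqP.
by apply: cohom_hom_add => m; rewrite /= subrK.
Qed.

Lemma cohom_zero (M N : rcomodules cC) x : (fmap h (rcomod_zero M N) : bihom _ _) x = 0.
Proof.
move: x; apply: (@cohom_extP _ _ _ (bzero _ _)) => m.
by rewrite tmap_bzero -cohom_unit_nat; apply: bhom0.
Qed.

Lemma cohom_exact_inj (M N : rcomodules cC) (f : rcomod_hom M N) :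
  cohom_exact h -> injective f -> injective (fmap h f : bihom _ _).
Proof.
move=> hE /exact_zero_inj fI; apply/exact_zero_inj => y.
have /(hE _ _ _ (rcomod_zero M M) f)/(_ y) -> : exact_at (rcomod_zero M M) f by [].
by split=> -[x xE]; exists x; rewrite -xE ?cohom_zero.
Qed.

(** * The isomorphism of h(W (x) C) with W (x) X *)

Section Cofree.
Variable W : rmod A.

(** The analogue of [ctheta] for an arbitrary right A-module W in place of C. *)
Definition wtheta : bihom (tens W C) (tens (tens W X) L) :=
  bcomp tassocV (tmap (bid W) (theta_bihom h)).

Lemma wtheta_colin (z : tens W C) :
  tens_coact (tens W X) L (wtheta z) = tmap wtheta (bid C) (@tens_coact k A C cC _ A W
    (coring_rcomod cC) z).
Proof.
rewrite -[LHS]/(tassocV (tmap _ _ (tassocV (tmap _ _ z)))).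
rewrite -[@tens_coact k A C cC _ A W (coring_rcomod cC) z]/(tassocV (tmap _ _ z)).
rewrite tmap_bid_tens -tassocV_nat tpentagonV !tmap_comp.
have -> y : tmap wtheta (bid C) y =
    tmap tassocV (bid C) (tmap (tmap (bid W) (theta_bihom h)) (bid C) y).
  by rewrite tmap_comp; apply: tmap_eq.
rewrite -tassocV_nat tmap_comp; congr (tmap _ _ (tassocV _)).
by apply: tmap_eq => // c; apply: theta_colin.
Qed.

Definition wtheta_hom : rcomod_hom (cofree_rcomod cC W) (tens_rcomod (tens W X) L) :=
  @RcomodHom k _ _ _ cC (cofree_rcomod cC W) (tens_rcomod (tens W X) L) wtheta wtheta_colin.

Definition cofree_to : bihom (h (cofree_rcomod cC W)) (tens W X) :=
  transpose (cohom_adj h) (Y := tens W X) wtheta_hom.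

Lemma cofree_toE z : tmap cofree_to (bid L) (rhom (eta (cofree_rcomod cC W)) z) = wtheta z.
Proof.
exact: (congr1 (fun g : rcomod_hom _ (tens_rcomod (tens W X) L) => g z)
  (transposeK (cohom_adj h) (Y := tens W X) wtheta_hom)).
Qed.

Let of_fun (w : W) (x : X) : h (cofree_rcomod cC W) :=
  (fmap h (rins (coring_rcomod cC) w) : bihom _ _) x.

(** Additivity in w is additivity of h. Balancedness reflects that A acts on X by functoriality:
    inserting w a amounts to inserting w after left multiplication by a. *)
Lemma cofree_of_balanced : balanced (@ract _ _ _ W) (@lact _ _ _ X) of_fun.
Proof.
split=> [w w' x|w x y|w a x].
- by apply: cohom_hom_add => c; apply: pureDl.
- exact: bhomD.
- rewrite -[RHS]cohom_comp /of_fun; congr bfun.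
  by apply: cohom_eq => c; apply: pure_bal.
Qed.

Lemma cofree_of_r w x b : of_fun w (ract x b) = ract (of_fun w x) b.
Proof. exact: bhomr. Qed.

Lemma cofree_of_l (c : base_alg k) w x : of_fun (lact c w) x = lact c (of_fun w x).
Proof.
have [_ _ bal] := cofree_of_balanced.
by rewrite -base_act bal act_sym cofree_of_r base_act.
Qed.

Definition cofree_of : bihom (tens W X) (h (cofree_rcomod cC W)) :=
  tens_lift cofree_of_balanced cofree_of_l cofree_of_r.

Lemma cofree_ofE w x :
  cofree_of (pure w x) = (fmap h (rins (coring_rcomod cC) w) : bihom _ _) x.
Proof. exact: tens_liftE. Qed.

(* [tins X w] with the k-action that h(C) has as an object of M_B, which is not the
   one restricted from A up to conversion. *)
Definition cohom_ins (w : W) : bihom (h (regular_rcomod cC)) (tens W X).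
Proof.
exists (fun x => pure w (x : X)) => [x y|c x|x s].
- exact: pureDr.
- rewrite act_sym; transitivity (ract (pure w (x : X)) (alg_str B c)).
    by rewrite ract_pure.
  by rewrite base_act.
- by rewrite ract_pure.
Defined.

Lemma cofree_ofK : cancel cofree_of cofree_to.
Proof.
move=> z; elim/tens_ind: z => [w x|x y IHx IHy]; last by rewrite !bhomD IHx IHy.
rewrite cofree_ofE; move: x.
apply: (@cohom_extP _ _ (bcomp cofree_to (fmap h (rins (coring_rcomod cC) w))) (cohom_ins
  w)) => c.
transitivity (tmap cofree_to (bid L)
    (tmap (fmap h (rins (coring_rcomod cC) w) : bihom _ _) (bid L) (rhom (eta _) c))).
  by rewrite tmap_comp; apply: tmap_eq.
rewrite -(cohom_unit_nat h (rins (coring_rcomod cC) w) c) cofree_toE.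
rewrite -[LHS]/(tassocV (tmap _ _ (pure w c))) tmapE; exact: tins_assocV.
Qed.

Lemma cofree_toK : cancel cofree_to cofree_of.
Proof.
apply: (@cohom_extP _ _ (bcomp cofree_of cofree_to) (bid _)) => z.
transitivity (tmap cofree_of (bid L) (wtheta z)).
  by rewrite -cofree_toE tmap_comp; apply: tmap_eq.
rewrite tmap_id; elim/tens_ind: z => [w c|x y IHx IHy]; last by rewrite !bhomD IHx IHy.
rewrite -[wtheta _]/(tassocV (tmap _ _ (pure w c))) tmapE.
have -> : tassocV (pure w (theta_bihom h c)) = tmap (cohom_ins w) (bid L) (theta_bihom h c).
  exact: tins_assocV.
rewrite [RHS](cohom_unit_nat h (rins (coring_rcomod cC) w) c) tmap_comp.
by apply: tmap_eq => // x; apply: cofree_ofE.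
Qed.

End Cofree.

Definition cotens_of_fun (M : rcomodules cC) : bihom (h M) (tens M X) :=
  bcomp (cofree_to M) (fmap h (coact_hom M)).

Lemma cotens_of_unit (M : rcomodules cC) (m : M) :
  tmap (cotens_of_fun M) (bid L) (rhom (eta M) m) =
  tassocV (tmap (bid M) (theta_bihom h) (rcoact M m)).
Proof.
transitivity (tmap (cofree_to M) (bid L)
  (tmap (fmap h (coact_hom M) : bihom _ _) (bid L) (rhom (eta M) m))).
  by rewrite tmap_comp; apply: tmap_eq.
by rewrite -(cohom_unit_nat h (coact_hom M) m) cofree_toE.
Qed.

(** Tested on the unit of h, the coaction of X becomes the coproduct of C by [cohom_coact_theta],
    and the claim becomes coassociativity of M. *)
Lemma cotens_of_subproof (M : rcomodules cC) x :
  cotens_of_fun M x \in @cotensor_pred _ _ _ _ _ _ M X.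
Proof.
apply/cotensorP; move: x.
apply: (@cohom_extP _ _ (bcomp (tmap (rcoact M) (bid X)) (cotens_of_fun M))
  (bcomp tassocV (bcomp (tmap (bid M) (lcoact X)) (cotens_of_fun M)))) => m.
transitivity (tmap (tmap (rcoact M) (bid X)) (bid L)
    (tmap (cotens_of_fun M) (bid L) (rhom (eta M) m))).
  by rewrite tmap_comp; apply: tmap_eq.
transitivity (tmap tassocV (bid L) (tmap (tmap (bid M) (lcoact X)) (bid L)
    (tmap (cotens_of_fun M) (bid L) (rhom (eta M) m)))); last first.
  by rewrite !tmap_comp; apply: tmap_eq.
rewrite cotens_of_unit -!tassocV_nat !tmap_comp.
have -> : tmap (bcomp (bid M) (bid M)) (bcomp (tmap (lcoact X) (bid L)) (theta_bihom h))
  (rcoact M m)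
   = tmap (bid M) tassocV (tmap (bid M) (tmap (bid C) (theta_bihom h))
        (tmap (bid M) (comul cC) (rcoact M m))).
  rewrite !tmap_comp; apply: tmap_eq => // c; exact: cohom_coact_theta.
rewrite -tpentagonV; congr (tassocV _).
rewrite -rcoactA -tassoc_nat tassocK tmap_comp.
by apply: tmap_eq => c; rewrite ?[RHS]tmap_id ?[LHS]tmap_id.
Qed.

Definition cotens_of (M : rcomodules cC) : bihom (h M) (cotens M X).
Proof.
exists (fun x => Cotensor (cotens_of_subproof x)) => *; apply: cotensor_inj.
- exact: (bhomD (cotens_of_fun M)).
- exact: (bhoml (cotens_of_fun M)).
- exact: (bhomr (cotens_of_fun M)).
Defined.

Lemma cotens_of_nat (M N : rcomodules cC) (f : rcomod_hom M N) x :
  cotens_of N ((fmap h f : bihom _ _) x) = cotens_map f (lcomod_id X) (cotens_of M x).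
Proof.
apply: cotensor_inj; move: x.
apply: (@cohom_extP _ _ (bcomp (cotens_of_fun N) (fmap h f))
  (bcomp (tmap f (bid X)) (cotens_of_fun M))) => m.
transitivity (tmap (cotens_of_fun N) (bid L)
    (tmap (fmap h f : bihom _ _) (bid L) (rhom (eta M) m))).
  by rewrite tmap_comp; apply: tmap_eq.
transitivity (tmap (tmap f (bid X)) (bid L)
    (tmap (cotens_of_fun M) (bid L) (rhom (eta M) m))); last first.
  by rewrite tmap_comp; apply: tmap_eq.
rewrite -(cohom_unit_nat h f) !cotens_of_unit rhom_colin -tassocV_nat !tmap_comp.
by congr (tassocV _); apply: tmap_eq => // c; rewrite ?[RHS]tmap_id ?[LHS]tmap_id.
Qed.
End CohomCotensor.

(** * The cohom functor is a cotensor product *)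

Lemma tunitr_nat (k : comPzRingType) (R S : alg k) (M N : bimod R S) (f : bihom M N)
  (x : tens M (regular_bimod S)) :
  tunitr (tmap f (bid (regular_bimod S)) x) = f (tunitr x).
Proof.
elim/tens_ind: x => [m s|x y IHx IHy]; last by rewrite !bhomD IHx IHy.
by rewrite tmapE !tunitrE bhomr.
Qed.

(** * Bicolinear maps C (x) C -> C and retractions of coactions *)

Section Coseparable.
Variables (k : comPzRingType) (A : alg k) (C : bimod A A) (cC : coring C).
Variable p : bihom (tens C C) C.
Hypothesis pK : forall c, p (comul cC c) = c.
Hypothesis p_right : forall z, comul cC (p z) =
  tmap p (bid C) (tassocV (tmap (bid C) (comul cC) z)).
Hypothesis p_left : forall z, comul cC (p z) =
  tmap (bid C) p (tassoc (tmap (comul cC) (bid C) z)).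

(** The cointegral attached to [p]: bicolinearity gives c_1 q(c_2 (x) d) = p(c (x) d) = q(c (x) d_1)
    d_2. *)
Let q : bihom (tens C C) (regular_bimod A) := bcomp (coeps cC) p.

Section Retraction.
Variable M : rcomodules cC.

Let s : bihom (tens (tens M C) C) M := bcomp tunitr (bcomp (tmap (bid M) q) tassoc).

Definition coact_retr_fun : bihom (tens M C) M := bcomp s (tmap (rcoact M) (bid C)).

(** The map is m (x) c |-> m_0 q(m_1 (x) c). By coassociativity its coaction is m_0 (x) m_1 q(m_2
    (x) c), and [p_left] contracts the last factors to p(m_1 (x) c). *)
Lemma coact_retr_coact z : rcoact M (coact_retr_fun z) =
  tmap (bid M) p (tassoc (tmap (rcoact M) (bid C) z)).
Proof.
set y := tmap _ _ z.
rewrite -[coact_retr_fun z]/(tunitr (tmap (bid M) q (tassoc y))) -tunitr_nat tmap_comp.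
have -> : tmap (bcomp (rcoact M) (bid M)) (bcomp (bid (regular_bimod A)) q) (tassoc y)
    = tmap (bid (tens M C)) q (tassoc (tmap tassocV (bid C)
        (tmap (tmap (bid M) (comul cC)) (bid C) y))).
  transitivity (tmap (bid (tens M C)) q (tassoc (tmap (tmap (rcoact M) (bid C)) (bid C) y))).
    rewrite tassoc_nat tmap_comp; apply: tmap_eq => // d.
    exact: (congr1 (fun t => q t) (esym (tmap_id d))).
  congr (tmap _ _ (tassoc _)); rewrite /y !tmap_comp; apply: tmap_eq => // m.
  by rewrite -[RHS]/(tassocV (tmap _ _ _)) -rcoactA tassocK.
elim/tens_ind: y => [u c|x y IHx IHy]; last by rewrite !bhomD IHx IHy.
elim/tens_ind: u => [n d|x y IHx IHy]; last by rewrite pureDl !bhomD IHx IHy.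
rewrite !tmapE tassocE tmapE.
have -> v : tunitr (tmap (bid (tens M C)) q (tassoc (pure (tassocV (pure n v)) c))) =
    pure n (tunitr (tmap (bid C) q (tassoc (pure v c)))).
  elim/tens_ind: v => [a b|x y IHx IHy]; last by rewrite pureDr !(bhomD, pureDl) IHx IHy pureDr.
  by rewrite tassocVE !tassocE !tmapE !tunitrE ract_pure.
congr (pure n _); rewrite -[RHS](coepsr cC) p_left tmapE tmap_comp.
by congr (tunitr _); apply: tmap_eq.
Qed.

(** The right side is m_0 (x) q(m_1 (x) c_1) c_2, which [p_right] turns into the value found in
    [coact_retr_coact]. *)
Lemma coact_retr_colin z :
  rcoact M (coact_retr_fun z) = tmap coact_retr_fun (bid C) (@rcoact _ _ _ _ _
    (cofree_rcomod cC M) z).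
Proof.
rewrite coact_retr_coact -[X in _ = tmap _ _ X]/(tassocV (tmap (bid M) (comul cC) z)).
elim/tens_ind: z => [m c|x y IHx IHy]; last by rewrite !bhomD IHx IHy.
rewrite !tmapE.
have -> v : tmap coact_retr_fun (bid C) (tassocV (pure m v)) =
    tmap s (bid C) (tassocV (pure (rcoact M m) v)).
  elim/tens_ind: v => [a b|x y IHx IHy]; last by rewrite !(pureDr, bhomD) IHx IHy.
  by rewrite !tassocVE !tmapE -[coact_retr_fun _]/(s (tmap _ _ _)) tmapE.
elim/tens_ind: (rcoact M m) => [n d|x y IHx IHy]; last first.
  by rewrite !pureDl !bhomD IHx IHy.
rewrite tassocE tmapE.
have -> v : tmap s (bid C) (tassocV (pure (pure n d) v)) =
    pure n (tunitl (tmap q (bid C) (tassocV (pure d v)))).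
  elim/tens_ind: v => [a b|x y IHx IHy]; last by rewrite !(pureDr, bhomD) IHx IHy.
  rewrite !tassocVE !tmapE tunitlE -pure_bal; congr (pure _ _).
  by rewrite -[s _]/(tunitr (tmap _ _ (tassoc _))) tassocE tmapE tunitrE.
congr (pure n _); rewrite -[LHS](coepsl cC) p_right tmapE tmap_comp.
by congr (tunitl _); apply: tmap_eq.
Qed.

(** With the multiplication of a Frobenius system as [p], the same map becomes the counit in
    [cofree_forget_adjunction]. *)
Definition coact_retr : rcomod_hom (cofree_rcomod cC M) M :=
  @RcomodHom _ _ _ _ _ (cofree_rcomod cC M) M coact_retr_fun coact_retr_colin.

Lemma coact_retrK m : coact_retr (rcoact M m) = m.
Proof.
rewrite -[LHS]/(tunitr (tmap _ _ (tassoc (tmap (rcoact M) (bid C) _)))).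
rewrite rcoactA tmap_comp -[RHS]rcoact_eps; congr (tunitr _).
by apply: tmap_eq => // c; rewrite /= pK.
Qed.

End Retraction.

Lemma coact_retr_nat (M N : rcomodules cC) (f : rcomod_hom M N) z :
  f (coact_retr M z) = coact_retr N (tmap f (bid C) z).
Proof.
rewrite -[coact_retr M z]/(tunitr (tmap _ _ (tassoc (tmap (rcoact M) (bid C) _)))).
rewrite -tunitr_nat.
rewrite -[RHS]/(tunitr (tmap _ _ (tassoc (tmap (rcoact N) (bid C) _)))); congr (tunitr _).
have -> : tmap (rcoact N) (bid C) (tmap f (bid C) z) =
    tmap (tmap f (bid C)) (bid C) (tmap (rcoact M) (bid C) z).
  by rewrite !tmap_comp; apply: tmap_eq => // m; rewrite [LHS]rhom_colin.
rewrite tassoc_nat !tmap_comp; apply: tmap_eq => // d.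
exact: (congr1 (fun t => q t) (esym (tmap_id d))).
Qed.

End Coseparable.

Section CohomIso.
Variables (k : comPzRingType) (A B : alg k) (C : bimod A A) (cC : coring C).
Variables (L : rcomod B cC) (h : cohom L).
Local Notation X := (cohom_lcomod h).

(** Under h(W (x) C) = W (x) X the two maps become rho_M (x) X and M (x) lambda_X, which agree on z
    by the definition of M [] X. *)
Lemma cofree_of_coact (M : rcomodules cC) (z : cotensor M X) :
  (fmap h (cofree_hom cC (rcoact M)) : bihom _ _) (cofree_of h M z) =
  (fmap h (coact_hom (cofree_rcomod cC M)) : bihom _ _) (cofree_of h M z).
Proof.
have -> : (fmap h (cofree_hom cC (rcoact M)) : bihom _ _) (cofree_of h M z) =
    cofree_of h (tens M C) (tmap (rcoact M) (bid X) z).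
  elim/tens_ind: (z : tens M X) => [m x|x y IHx IHy]; last by rewrite !bhomD IHx IHy.
  rewrite tmapE !cofree_ofE -cohom_comp; congr bfun.
  by apply: cohom_eq => c; apply: tmapE.
rewrite cotensor_eq.
elim/tens_ind: (z : tens M X) => [m x|x y IHx IHy]; last by rewrite !bhomD IHx IHy.
rewrite tmapE cofree_ofE -cohom_comp.
set f := rcomod_comp _ _; rewrite -[RHS](cofree_toK (W := tens M C)); congr (cofree_of _ _ _).
(* [g] is x |-> m (x) lambda(x), rebracketed and typed as a map out of h(C), so that [cohom_extP]
   reduces the comparison to elements c of C. *)
pose g : bihom (h (regular_rcomod cC)) (tens (tens M C) X) :=
  bcomp tassocV (bcomp (tins (tens C X) m) (cohom_coact_fun h)).
transitivity (g x) => //; move: x.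
apply: (@cohom_extP _ _ _ _ _ _ h _ _ _ (bcomp (cofree_to h (tens M C)) (fmap h f))) => c.
transitivity (tmap (cofree_to h (tens M C)) (bid L)
    (rhom (adj_unit (cohom_adj h) _) (f c))); last first.
  by rewrite (cohom_unit_nat h f c) tmap_comp; apply: tmap_eq.
rewrite cofree_toE.
transitivity (tmap tassocV (bid L) (tmap (tins (tens C X) m) (bid L)
    (tmap (cohom_coact_fun h) (bid L) (theta h c)))).
  by rewrite !tmap_comp; apply: tmap_eq.
rewrite cohom_coact_theta -[tmap (tins _ _) _ _]tins_assocV.
rewrite -[RHS]/(tassocV (tmap _ _ (tassocV (tmap _ _ (pure m c))))) tmapE.
rewrite tmap_bid_tens -tassocV_nat tpentagonV tmapE.
rewrite -[ctheta _ _]/(tassocV (tmap (bid C) (theta_bihom h) (comul cC c))).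
by rewrite tmapE.
Qed.

Lemma cotens_of_inj (M : rcomodules cC) :
  injective (fmap h (coact_hom M) : bihom _ _) -> injective (cotens_of h M).
Proof.
move=> hI x y /(congr1 (@cotensor_val _ _ _ _ _ _ _ _)) e; apply: hI.
exact: (can_inj (@cofree_toK _ _ _ _ _ _ h M)) e.
Qed.

Lemma cotens_of_surj (M : rcomodules cC) :
  (forall y, (fmap h (cofree_hom cC (rcoact M)) : bihom _ _) y =
     (fmap h (coact_hom (cofree_rcomod cC M)) : bihom _ _) y ->
     exists x, (fmap h (coact_hom M) : bihom _ _) x = y) ->
  forall z, exists x, cotens_of h M x = z.
Proof.
move=> hS z; have [x xE] := hS _ (cofree_of_coact z).
exists x; apply: cotensor_inj.
by rewrite -[LHS]/(cofree_to h M ((fmap h (coact_hom M) : bihom _ _) x)) xE cofree_ofK.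
Qed.

Lemma coact_hom_inj (M : rcomodules cC) : injective (coact_hom M).
Proof. by move=> x y /(congr1 (fun z => tunitr (tmap (bid M) (coeps cC) z))); rewrite
  !rcoact_eps. Qed.

(** The parallel pair is replaced by its difference so that [cohom_exact] applies. Contracting with
    the counit of C provides the preimage. *)
Lemma coact_hom_exact (M : rcomodules cC) : exact_at (coact_hom M)
  (rcomod_sub (cofree_hom cC (rcoact M)) (coact_hom (cofree_rcomod cC M))).
Proof.
move=> y; rewrite -[rcomod_sub _ _ y]/(tmap (rcoact M) (bid C) y - tassocV (tmap (bid M)
  (comul cC) y)).
split=> [/eqP|[m <-]]; last first.
  by rewrite -[coact_hom M m]/(rcoact M m) -rcoactA tassocK subrr.
rewrite subr_eq0 => /eqP yE; exists (tunitr (tmap (bid M) (coeps cC) y)).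
transitivity (tunitr (tmap (bid (tens M C)) (coeps cC) (tmap (rcoact M) (bid C) y))).
  rewrite -[LHS]tunitr_nat !tmap_comp; congr (tunitr _); exact: tmap_eq.
rewrite yE tmap_bid_tens -tassocV_nat tunitr_assocV !tmap_comp -[RHS]tmap_id.
by apply: tmap_eq => // c; apply: coepsr.
Qed.

Hypothesis hC : cohom_exact h \/ coseparable cC.

Lemma coact_hom_cohom (M : rcomodules cC) :
  injective (fmap h (coact_hom M) : bihom _ _) /\
  forall y, (fmap h (cofree_hom cC (rcoact M)) : bihom _ _) y =
     (fmap h (coact_hom (cofree_rcomod cC M)) : bihom _ _) y ->
     exists x, (fmap h (coact_hom M) : bihom _ _) x = y.
Proof.
case: hC => [hE|[p [pK p_right p_left]]]; split.
- exact/(cohom_exact_inj hE)/coact_hom_inj.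
- move=> y yE; apply/(hE _ _ _ _ _ (@coact_hom_exact M)).
  by rewrite cohom_hom_sub yE subrr.
- apply: (can_inj (g := fmap h (coact_retr p_right p_left M) : bihom _ _)) => x.
  by rewrite -cohom_comp; apply: cohom_id => m; apply: coact_retrK.
(* The fork is a split equalizer. With r the retraction, naturality gives rho_M r_M = r_(M (x) C)
   (rho_M (x) C); then [yE] replaces rho_M (x) C by the coaction of M (x) C, which r_(M (x) C)
   splits. *)
move=> y yE; exists ((fmap h (coact_retr p_right p_left M) : bihom _ _) y).
rewrite -cohom_comp.
have -> : fmap h (rcomod_comp (coact_hom M) (coact_retr p_right p_left M)) =
  fmap h (rcomod_comp (coact_retr p_right p_left (cofree_rcomod cC M)) (cofree_hom cC
    (rcoact M))).
  by apply: cohom_eq => m; apply: (coact_retr_nat _ _ (coact_hom M)).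
rewrite cohom_comp yE -cohom_comp; apply: cohom_id => m.
exact: coact_retrK.
Qed.

Lemma cotens_of_bij (M : rcomodules cC) :
  {g : bihom (cotens M X) (h M) | cancel (cotens_of h M) g & cancel g (cotens_of h M)}.
Proof.
have [hI hS] := coact_hom_cohom M.
exact: binverse (cotens_of_inj hI) (cotens_of_surj hS).
Qed.

Lemma cotens_adjunction : {ad : adjunction (cotens_functor X) (tens_functor L) |
  forall (M : rcomodules cC) (m : M),
   tmap (cotens_val : bihom (cotens M X) (tens M X)) (bid L) (rhom (adj_unit ad M) m) =
     tassocV (tmap (bid M) (theta_bihom h) (rcoact M m))}.
Proof.
pose u (M : rcomod_cat cC (base_alg k)) : hom (h M) (cotens_functor X M) := cotens_of h M.
pose v (M : rcomod_cat cC (base_alg k)) : hom (cotens_functor X M) (h M) :=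
  let: exist2 g _ _ := cotens_of_bij M in g.
have [|M|M|ad adE] := @adjunction_transfer _ _ _ _ _ (cohom_adj h) u v.
- by move=> M N f; apply: bihom_ext => x; apply: cotens_of_nat.
- by rewrite /v; case: cotens_of_bij => g gK fK; apply: bihom_ext => x; apply: fK.
- by rewrite /v; case: cotens_of_bij => g gK fK; apply: bihom_ext => x; apply: gK.
exists ad => M m; rewrite adE -cotens_of_unit tmap_comp.
exact: tmap_eq.
Qed.
End CohomIso.

(** * Injectivity of the inclusion of the comatrix coring *)

Lemma lflat_inj (k : comPzRingType) (R S : alg k) (N : bimod R S) (V W : rmod R)
  (f : bihom V W) : lflat N -> injective f -> injective (tmap f (bid N)).
Proof.
move=> Nf /exact_zero_inj /Nf fE; apply/exact_zero_inj => y.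
by rewrite fE; split=> -[x xE]; exists x; rewrite -xE tmap_bzero.
Qed.

Section KernelComodule.
Variables (k : comPzRingType) (A : alg k) (C : bimod A A) (cC : coring C).
Hypothesis Cflat : lflat C.
Variables (M N : rcomodules cC) (f : rcomod_hom M N).

(** Flatness makes K (x) C the kernel of f (x) C, so the coaction of M restricts to K. The axioms
    are inherited through the injections of K (x) C (x) C into M (x) C (x) C and of K into M. *)
Lemma kernel_comodule : exists (K : rcomodules cC) (i : rcomod_hom K M), exact_at i f.
Proof.
pose K := bker f; pose i : bihom K M := bker_val f.
have iC : injective (tmap i (bid C)) by apply: lflat_inj (@bker_val_inj _ _ _ _ _ f).
have iCC : injective (tmap i (bid (tens C C))).
  move=> x y xy; rewrite -[x]tassocVK -[y]tassocVK; congr (tassoc _).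
  apply: (lflat_inj Cflat iC); rewrite -!tassocV_nat; congr (tassocV _).
  have e z : tmap i (tmap (bid C) (bid C)) z = tmap i (bid (tens C C)) z.
    by apply: tmap_eq => // c; apply: tmap_id.
  by rewrite !e.
have [r rE] : {r : bihom K (tens K C) | forall x, tmap i (bid C) (r x) = rcoact M (i x)}.
  apply: (bfactor (g := bcomp (rcoact M) i)) => // x.
  apply/(Cflat (@bker_exact _ _ _ _ _ f)).
  by rewrite -[bcomp _ _ x]/(rcoact M (i x)) -rhom_colin [f _]ker_eq0 bhom0.
have rA x : tassoc (tmap r (bid C) (r x)) = tmap (bid K) (comul cC) (r x).
  apply: iCC; transitivity (tmap (bid M) (comul cC) (tmap i (bid C) (r x))); last first.
    by rewrite !tmap_comp; apply: tmap_eq.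
  rewrite rE -rcoactA -rE tmap_comp.
  have -> z : tmap i (bid (tens C C)) (tassoc z) = tassoc (tmap (tmap i (bid C)) (bid C) z).
    by rewrite tassoc_nat; apply: tmap_eq => // c; rewrite tmap_id.
  by rewrite tmap_comp; congr (tassoc _); apply: tmap_eq => // m; apply: rE.
have r1 x : tunitr (tmap (bid K) (coeps cC) (r x)) = x.
  apply: (@bker_val_inj _ _ _ _ _ f); rewrite -[LHS]tunitr_nat tmap_comp.
  transitivity (tunitr (tmap (bid M) (coeps cC) (tmap i (bid C) (r x)))).
    by rewrite tmap_comp; congr (tunitr _); apply: tmap_eq.
  by rewrite rE rcoact_eps.
exists (Rcomod rA r1).
by exists (@RcomodHom _ _ _ _ _ (Rcomod rA r1) M i (fun x => esym (rE x))); apply: bker_exact.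
Qed.

End KernelComodule.

Section TensInj.
Variables (k : comPzRingType) (A B : alg k) (C : bimod A A) (cC : coring C).
Variables (L : rcomod B cC) (h : cohom L).
Local Notation X := (cohom_lcomod h).
Local Notation G f := (cotens_map f (lcomod_id X)).

(* A right adjoint preserves monomorphisms, and those of M^C are injective when C
   is left flat. *)
Lemma tens_rcomod_hom_inj (V W : rmod B) (f : bihom V W) :
  lflat C -> injective f -> injective (tens_rcomod_hom f L).
Proof.
move=> Cf fI; apply: bhom_inj => x fx0.
have [K [i iE]] := kernel_comodule Cf (tens_rcomod_hom f L).
have [y <-] := (iE x).1 fx0.
suff -> : i = rcomod_zero K (tens_rcomod V L) by [].
apply: (right_adjoint_mono (cohom_adj h) (f := f : hom (V : bimod_cat _ _) W)) => [M u v uv|].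
  by apply: bihom_ext => z; apply: fI; apply: (congr1 (fun g : bihom M W => g z) uv).
apply: rcomod_hom_ext => t; transitivity (0 : tens W L); first by apply/iE; exists t.
by rewrite -[RHS]/(tmap f (bid L) 0) bhom0.
Qed.

Lemma cotens_map_comp (M N P : rcomodules cC) (f : rcomod_hom N P) (g : rcomod_hom M N) z :
  G (rcomod_comp f g) z = G f (G g z).
Proof. exact: (congr1 (fun u : bihom (cotens M X) (cotens P X) => u z) (fmapM
  (cotens_functor X) f g)). Qed.

Lemma cotens_map_eq (M N : rcomodules cC) (f g : rcomod_hom M N) z :
  (forall m, f m = g m) -> G f z = G g z.
Proof. by move/rcomod_hom_ext->. Qed.

Lemma cotens_map_id (M : rcomodules cC) (f : rcomod_hom M M) z :
  (forall m, f m = m) -> G f z = z.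
Proof.
move=> f1; rewrite (_ : f = rcomod_id M); last exact: rcomod_hom_ext.
exact: (congr1 (fun u : bihom (cotens M X) (cotens M X) => u z) (fmap1 (cotens_functor X) M)).
Qed.

Lemma cotens_forgetK_subproof (z : cotensor L X) :
  (z : tens L X) \in @cotensor_pred _ _ _ _ _ _ (rcomod_forget_left L) X.
Proof. exact/cotensorP/(cotensor_eq z). Qed.

(** The elements are the same, but the two cotensor products are distinct types, since the type
    records the comodule L together with its left action. The identification is therefore an
    explicit pair of inverse maps. *)
Definition cotens_restr : bihom (forget_left (cotens L X)) (cotens (rcomod_forget_left L) X).
Proof.
exists (fun z => @Cotensor _ _ _ _ _ _ (rcomod_forget_left L) X _
  (cotens_forgetK_subproof z)) => *; by apply: cotensor_inj.
Defined.

Definition cotens_unrestr : bihom (cotens (rcomod_forget_left L) X) (forget_left (cotens L X)).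
Proof.
exists (fun z => cotens_forget z : cotens L X) => *; by apply: cotensor_inj.
Defined.

Definition cotens_incl : bihom (forget_left (cotens L X)) (forget_left (tens L X)) :=
  @Bihom k _ B (forget_left (cotens L X)) (forget_left (tens L X))
    (@cotensor_val _ _ _ _ _ _ L X) (fun _ _ => erefl) (fun _ _ => erefl) (fun _ _ => erefl).

(** Through [tens_cotens] this gives injectivity of E (x) E -> (L (x) X) (x) (L (x) X), where
    [is_comatrix_coring] compares coproducts. *)
Definition cotens_incl_mono : Prop :=
  injective (G (tens_rcomod_hom cotens_incl L)).

Lemma cotens_incl_monoP : lflat C -> cohom_exact h \/ coseparable cC -> cotens_incl_mono.
Proof.
move=> Cf hC.
have bij (M : rcomodules cC) := cotens_of_bij hC M.
case: hC => [hE|[p [pK p_right p_left]]].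
  have inclI : injective cotens_incl by move=> x y; apply: cotensor_inj.
  have hI := cohom_exact_inj hE (tens_rcomod_hom_inj Cf inclI).
  move=> x y; have [g fK gK] := bij (tens_rcomod (forget_left (cotens L X)) L).
  rewrite -(gK x) -(gK y) -!cotens_of_nat.
  by have [g' fK' _] := bij (tens_rcomod (forget_left (tens L X)) L); move/(can_inj fK')/hI->.
have [g fK gK] := bij (rcomod_forget_left L).
(* In the coseparable case the inclusion is h of the coaction of L, up to the isomorphisms of h(L)
   with L [] X and of h(L (x) C) with L (x) X. The image under h of the retraction of this coaction
   therefore splits it. *)
pose t0 : bihom (tens (rcomod_forget_left L) X) (forget_left (cotens L X)) :=
  bcomp cotens_unrestr (bcomp (cotens_of h _)
  (bcomp (fmap h (coact_retr p_right p_left (rcomod_forget_left L)))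
    (cofree_of h (rcomod_forget_left L)))).
have t0r (x : tens L X) s : t0 (ract x s) = ract (t0 x) s by apply: bhomr.
have t0l (c : base_alg k) (x : tens L X) : t0 (lact (alg_str B c) x) = lact (alg_str B c)
  (t0 x).
  by rewrite act_sym t0r -act_sym.
pose t := @Bihom k _ _ (forget_left (tens L X)) (forget_left (cotens L X)) t0 (bhomD t0)
  t0l t0r.
have tK z : t (cotens_incl z) = z.
  apply: cotensor_inj.
  have := gK (cotens_restr z); set x := g _ => xE.
  transitivity (cotensor_val (cotens_restr z)) => //.
  suff yE : (fmap h (coact_retr p_right p_left (rcomod_forget_left L)) : bihom _ _)
      (cofree_of h (rcomod_forget_left L) (cotensor_val (cotens_restr z))) = x.
    by rewrite -xE -yE.
  rewrite -xE.
  rewrite -[cotensor_val _]/(cofree_to h _ ((fmap h (coact_hom (rcomod_forget_left L)) :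
    bihom _ _) x)).
  rewrite cofree_toK -cohom_comp; apply: cohom_id => m; exact: coact_retrK.
apply: (can_inj (g := G (tens_rcomod_hom t L))) => z.
rewrite -cotens_map_comp; apply: cotens_map_id => w.
rewrite [LHS]tmap_comp -[RHS]tmap_id; exact: tmap_eq.
Qed.
End TensInj.

(** * The comonad of the adjunction *)

Section CotensorAdjunction.
Variables (k : comPzRingType) (A B : alg k) (C : bimod A A) (cC : coring C).
Variables (L : rcomod B cC) (h : cohom L).
Local Notation X := (cohom_lcomod h).
Local Notation E := (cotens L X).
Local Notation Ek := (forget_left (cotens L X)).
Local Notation Lk := (rcomod_forget_left L).
Local Notation G f := (cotens_map f (lcomod_id X)).
Local Notation T f := (tens_rcomod_hom f L).
Local Notation tc := (@tens_cotens k A B C cC L h).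

Lemma cotens_restrK : cancel (cotens_restr h) (cotens_unrestr h).
Proof. by move=> z; apply: cotensor_inj. Qed.

Lemma cotens_unrestrK : cancel (cotens_unrestr h) (cotens_restr h).
Proof. by move=> z; apply: cotensor_inj. Qed.

Lemma tmap_lact (R S T : alg k) (M : bimod R S) (N : bimod S T) (r : R) (y : tens M N) :
  tmap (lmul_hom M r) (bid N) y = lact r y.
Proof.
elim/tens_ind: y => [m n|x y IHx IHy]; first by rewrite lact_pure [LHS]tmapE.
by rewrite lactDr [LHS](bhomD (tmap (lmul_hom M r) (bid N))) IHx IHy.
Qed.

Lemma rcomod_hom_by_ins (V : rmod B) (N : rcomodules cC) (u : bihom (tens V L) N) :
  (forall v, exists g : rcomod_hom Lk N, forall l, u (pure v l) = g l) ->
  forall y, rcoact N (u y) = tmap u (bid C) (rcoact (tens_rcomod V L) y).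
Proof.
move=> ug y; elim/tens_ind: y => [v l|x y IHx IHy]; last by rewrite !bhomD IHx IHy.
have [g gE] := ug v; rewrite gE rhom_colin.
rewrite -[pure v l]/(rins L v l) [X in tmap u _ X](rhom_colin (rins L v)) tmap_comp.
by apply: tmap_eq => // m; rewrite -gE.
Qed.

(** This description by insertions is what allows identities about [tens_cotens] to be derived from
    functoriality of G and naturality. *)
Lemma tens_cotensE (V : rmod B) v z : tc V (pure v z) = G (rins L v) (cotens_restr h z).
Proof.
apply: cotensor_inj; rewrite -[LHS]/(tassocV (tmap _ _ (pure v z))) tmapE.
exact: tins_assocV.
Qed.

Lemma tens_cotens_nat (V W : rmod B) (f : bihom V W) w :
  tc W (tmap f (bid E) w) = G (T f) (tc V w).
Proof.
elim/tens_ind: w => [v z|x y IHx IHy]; last by rewrite !bhomD IHx IHy.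
rewrite tmapE !tens_cotensE -cotens_map_comp; apply: cotens_map_eq => l.
exact/esym/tmapE.
Qed.

Variable ad : adjunction (cotens_functor X) (tens_functor L).
Local Notation eta M := (adj_unit ad M : rcomod_hom M (tens_rcomod (cotens M X) L)).

Lemma cotens_unit_nat (M N : rcomodules cC) (f : rcomod_hom M N) m :
  eta N (f m) = tmap (G f) (bid L) (eta M m).
Proof. exact: (congr1 (fun g : rcomod_hom _ (tens_rcomod (cotens N X) L) => g m)
  (adj_unit_nat ad f)). Qed.

Lemma cotens_ext (M : rcomodules cC) (V : rmod B) (u v : bihom (cotens M X) V) :
  (forall m, tmap u (bid L) (eta M m) = tmap v (bid L) (eta M m)) -> forall x, u x = v x.
Proof.
move=> uv x; suff -> : u = v by [].
by apply: (adj_inj (ad := ad)); apply: rcomod_hom_ext.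
Qed.

Definition cotens_transpose (M : rcomodules cC) (V : rmod B) (f : rcomod_hom M
  (tens_rcomod V L)) :
  bihom (cotens M X) V := transpose ad (Y := V) f.

Lemma cotens_transposeK (M : rcomodules cC) (V : rmod B) (f : rcomod_hom M (tens_rcomod V
  L)) m :
  tmap (cotens_transpose f) (bid L) (eta M m) = f m.
Proof.
exact: (congr1 (fun g : rcomod_hom M (tens_rcomod V L) => g m) (transposeK ad (Y := V) f)).
Qed.

Definition unitL : rcomod_hom Lk (tens_rcomod Ek L) := rcomod_comp (T (cotens_unrestr h))
  (eta Lk).

Lemma unitL_restr l : tmap (cotens_restr h) (bid L) (unitL l) = eta Lk l.
Proof.
rewrite [LHS]tmap_comp -[RHS]tmap_id; apply: tmap_eq => // z; exact: cotens_unrestrK.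
Qed.

(** Naturality of the unit at the endomorphism l |-> b l of L; the left action of b on E is G of
    this endomorphism. *)
Lemma unitL_lact (b : B) (l : L) : unitL (lact b l) = lact b (unitL l : tens E L).
Proof.
have := cotens_unit_nat (rcomod_lmul L b) l => e.
rewrite -[LHS]/(tmap (cotens_unrestr h) (bid L) (eta Lk (rcomod_lmul L b l))) e.
rewrite -tmap_lact -[unitL l]/(tmap (cotens_unrestr h) (bid L) (eta Lk l)) !tmap_comp.
by apply: tmap_eq => // z; apply: cotensor_inj; apply: tmap_lact.
Qed.

Definition unitB : bihom L (tens E L) :=
  @Bihom k B A L (tens E L) unitL (bhomD unitL) unitL_lact (bhomr unitL).

(** * The isomorphism of V (x) (L [] X) with (V (x) L) [] X *)

Section TensUnit.
Variable V : rmod B.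

Definition tens_unit_fun : bihom (tens V L) (tens (tens V E) L) :=
  bcomp tassocV (tmap (bid V) unitB).

Lemma tens_unit_pure v l : tens_unit_fun (pure v l) = T (tins E v) (unitL l).
Proof.
rewrite -[LHS]/(tassocV (tmap _ _ (pure v l))) tmapE; exact: tins_assocV.
Qed.

Lemma tens_unit_colin y : rcoact (tens_rcomod (tens V E) L) (tens_unit_fun y) =
  tmap tens_unit_fun (bid C) (rcoact (tens_rcomod V L) y).
Proof.
move: y; apply: (@rcomod_hom_by_ins V (tens_rcomod (tens V E) L)) => v.
exists (rcomod_comp (T (tins E v)) unitL) => l; exact: tens_unit_pure.
Qed.

Definition tens_unit : rcomod_hom (tens_rcomod V L) (tens_rcomod (tens V E) L) :=
  @RcomodHom _ _ _ _ _ (tens_rcomod V L) (tens_rcomod (tens V E) L) tens_unit_fun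
    tens_unit_colin.

(** Naturality of the unit at insertions: its component at V (x) L is V tensored with its component
    at L. *)
Lemma tens_cotens_unit y : T (tc V) (tens_unit y) = eta (tens_rcomod V L) y.
Proof.
elim/tens_ind: y => [v l|x y IHx IHy]; last first.
  by rewrite bhomD [LHS]bhomD IHx IHy [RHS]bhomD.
rewrite [tens_unit _]tens_unit_pure.
rewrite [RHS](cotens_unit_nat (rins L v) l) -unitL_restr [LHS]tmap_comp [RHS]tmap_comp.
by apply: tmap_eq => // z; apply: tens_cotensE.
Qed.

(** Associativity of tensor and cotensor comes from the adjunction: the inverse is the transpose of
    V (x) [unitL], and uniqueness of transposes gives both cancellations. *)
Definition tens_cotens_inv : bihom (cotens (tens_rcomod V L) X) (tens V E) :=
  cotens_transpose tens_unit.

Lemma tens_cotens_invK : cancel tens_cotens_inv (tc V).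
Proof.
apply: (@cotens_ext _ _ (bcomp (tc V) tens_cotens_inv) (bid _)) => y.
transitivity (T (tc V) (tmap tens_cotens_inv (bid L) (eta _ y))).
  by rewrite [RHS]tmap_comp; apply: tmap_eq.
by rewrite cotens_transposeK tens_cotens_unit tmap_id.
Qed.

Lemma tens_cotensK : cancel (tc V) tens_cotens_inv.
Proof.
move=> w; elim/tens_ind: w => [v z|x y IHx IHy]; last by rewrite !bhomD IHx IHy.
rewrite tens_cotensE -[z in RHS]cotens_restrK; move: (cotens_restr h z).
apply: (@cotens_ext _ _ (bcomp tens_cotens_inv (G (rins L v))) (bcomp (tins E v)
  (cotens_unrestr h))) => l.
transitivity (tmap tens_cotens_inv (bid L) (tmap (G (rins L v)) (bid L) (eta _ l))).
  by rewrite tmap_comp; apply: tmap_eq.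
rewrite -cotens_unit_nat cotens_transposeK [LHS]tens_unit_pure [LHS]tmap_comp.
exact: tmap_eq.
Qed.

Lemma tens_cotens_inj : injective (tc V).
Proof. exact: can_inj tens_cotensK. Qed.

End TensUnit.

Section Coproduct.
Variable D : bihom E (tens E E).
(** The working form of the coproduct: read through [tens_cotens], it is the coproduct G eta_T of
    the comonad G T at B, with L in the role of T(B). *)
Hypothesis DE : forall z, tc Ek (D z) = G unitL (cotens_restr h z).

Lemma tens_cotens_comul (V : rmod B) (w : tens V E) :
  tc (tens V E) (tassocV (tmap (bid V) D w)) = G (tens_unit V) (tc V w).
Proof.
elim/tens_ind: w => [v z|x y IHx IHy]; last by rewrite !bhomD IHx IHy.
rewrite tmapE [tassocV _]tins_assocV [LHS]tens_cotens_nat DE tens_cotensE.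
rewrite -!cotens_map_comp; apply: cotens_map_eq => l.
exact/esym/tens_unit_pure.
Qed.

Definition comulk : bihom Ek (tens Ek E) :=
  @Bihom k _ B Ek (tens Ek E) D (bhomD D) (fun c z => bhoml D (alg_str B c) z) (bhomr D).

(** Coassociativity of L as a left E-comodule under [unitL]. It is naturality of the unit at the
    morphism [unitL] itself, compared after the split injection T([tc]). *)
Lemma unit_comul l : T comulk (unitL l) = tens_unit Ek (unitL l).
Proof.
have TtcI : injective (T (tc Ek)).
  apply: (can_inj (g := T (tens_cotens_inv Ek))) => y.
  by rewrite [LHS]tmap_comp -[RHS]tmap_id; apply: tmap_eq => // z; apply: tens_cotensK.
apply: TtcI; rewrite tens_cotens_unit.
rewrite [RHS](cotens_unit_nat unitL l) -unitL_restr [LHS]tmap_comp [RHS]tmap_comp.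
by apply: tmap_eq => // z; apply: DE.
Qed.

(** * The multiplication of E induced by a natural transformation from T G to the identity *)

Section Mult.
Variable n : forall M : rcomodules cC, rcomod_hom (tens_rcomod (cotens M X) L) M.
Hypothesis n_nat : forall (M N : rcomodules cC) (f : rcomod_hom M N) y,
  f (n M y) = n N (T (G f) y).

Definition multL : rcomod_hom (tens_rcomod Ek L) Lk := rcomod_comp (n Lk) (T (cotens_restr h)).

Lemma multL_lact (b : B) (y : tens E L) : multL (lact b y) = lact b (multL y : L).
Proof.
rewrite -[RHS]/(rcomod_lmul L b (n Lk (T (cotens_restr h) y))) n_nat.
rewrite -[LHS]/(n Lk (T (cotens_restr h) (lact b y))); congr (n Lk _).
rewrite -tmap_lact [LHS]tmap_comp [RHS]tmap_comp.
by apply: tmap_eq => // z; apply: cotensor_inj; apply/esym/tmap_lact.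
Qed.

Definition mult_fun : bihom (tens Ek E) Ek :=
  bcomp (cotens_unrestr h) (bcomp (G multL) (tc Ek)).

Lemma mult_restr y : cotens_restr h (mult_fun y) = G multL (tc Ek y).
Proof. exact: cotens_unrestrK. Qed.

Lemma mult_lact (b : B) (y : tens E E) : mult_fun (lact b y) = lact b (mult_fun y : E).
Proof.
elim/tens_ind: y => [e z|x y IHx IHy]; last first.
  rewrite lactDr; transitivity (mult_fun (lact b x) + mult_fun (lact b y)); first exact: bhomD.
  rewrite IHx IHy; transitivity (lact b (mult_fun x + mult_fun y : E)).
    by rewrite [RHS](@lactDr k B B E).
  by congr (@lact k B B E b _); apply/esym/(bhomD mult_fun).
rewrite lact_pure.
apply: (can_inj cotens_restrK); rewrite mult_restr tens_cotensE.
have -> : cotens_restr h (lact b (mult_fun (pure e z) : E)) =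
    G (rcomod_lmul L b) (cotens_restr h (mult_fun (pure e z))).
  by apply: cotensor_inj; apply/esym/tmap_lact.
rewrite mult_restr tens_cotensE -!cotens_map_comp; apply: cotens_map_eq => l.
by rewrite -[RHS]multL_lact lact_pure.
Qed.

Definition mult : bihom (tens E E) E :=
  @Bihom k B B (tens E E) E mult_fun (bhomD mult_fun) mult_lact (bhomr mult_fun).

(** Once [tens_cotens] and G are stripped off, this is naturality of the unit at [multL]. *)
Lemma mult_right y : D (mult y) = tmap mult (bid E) (tassocV (tmap (bid E) D y)).
Proof.
apply: (@tens_cotens_inj Ek); rewrite DE [cotens_restr _ _]mult_restr.
transitivity (G (T mult_fun) (tc (tens Ek E) (tassocV (tmap (bid Ek) D y)))); last first.
  exact/esym/(tens_cotens_nat mult_fun).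
rewrite tens_cotens_comul -!cotens_map_comp; apply: cotens_map_eq => t.
transitivity (tmap (cotens_unrestr h) (bid L)
    (tmap (G multL) (bid L) (tmap (tc Ek) (bid L) (tens_unit Ek t)))); last first.
  by rewrite -[RHS]/(tmap mult_fun (bid L) (tens_unit Ek t)) !tmap_comp; apply: tmap_eq.
by rewrite [X in tmap _ _ (tmap _ _ X)]tens_cotens_unit -cotens_unit_nat.
Qed.

Definition tens_multL (V : rmod B) : rcomod_hom (tens_rcomod (tens V E) L) (tens_rcomod V L) :=
  rcomod_comp (n (tens_rcomod V L)) (T (tc V)).

(** Naturality of [n] at the insertion of v: on V (x) L the transformation is V tensored with
    [multL]. *)
Lemma tens_multLE (V : rmod B) v (y : tens E L) :
  tens_multL V (T (tins E v) y) = pure v (multL y).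
Proof.
rewrite -[RHS]/(rins L v (multL y)) -[multL y]/(n Lk (T (cotens_restr h) y)) n_nat.
rewrite -[LHS]/(n _ (T (tc V) (T (tins E v) y))); congr (n _ _); rewrite [LHS]tmap_comp
  [RHS]tmap_comp.
by apply: tmap_eq => // z; apply: tens_cotensE.
Qed.

Lemma tens_cotens_mult (V : rmod B) (w : tens V (tens E E)) :
  tc V (tmap (bid V) mult w) = G (tens_multL V) (tc (tens V E) (tassocV w)).
Proof.
elim/tens_ind: w => [v y|x y IHx IHy]; last by rewrite !bhomD IHx IHy.
rewrite tmapE tens_cotensE [cotens_restr _ _]mult_restr [tassocV _]tins_assocV.
rewrite [X in _ = G _ X]tens_cotens_nat -!cotens_map_comp; apply: cotens_map_eq => t.
exact/esym/tens_multLE.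
Qed.

(** Dually to [mult_right], this is naturality of [n] at [unitL]. *)
Lemma mult_left y : D (mult y) = tmap (bid E) mult (tassoc (tmap D (bid E) y)).
Proof.
apply: (@tens_cotens_inj Ek); rewrite DE [cotens_restr _ _]mult_restr.
transitivity (G (tens_multL Ek) (tc (tens Ek E) (tmap comulk (bid E) y))); last first.
  by rewrite -[in LHS](tassocK (tmap comulk (bid E) y)) -tens_cotens_mult.
rewrite tens_cotens_nat -!cotens_map_comp; apply: cotens_map_eq => t.
rewrite -[LHS]/(unitL (n Lk (T (cotens_restr h) t))) n_nat.
rewrite -[RHS]/(n _ (T (tc Ek) (T comulk t))); congr (n _ _).
rewrite [LHS]tmap_comp [RHS]tmap_comp; apply: tmap_eq => // z.
exact/esym/DE.
Qed.

Lemma mult_comul : (forall M m, n M (eta M m) = m) -> forall z, mult (D z) = z.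
Proof.
move=> nK z; apply: (can_inj cotens_restrK); rewrite [LHS]mult_restr DE.
rewrite -cotens_map_comp; apply: cotens_map_id => l.
by rewrite -[LHS]/(n Lk (T _ (unitL l))) [X in n Lk X]unitL_restr nK.
Qed.

End Mult.
End Coproduct.
End CotensorAdjunction.

(** * The comatrix coring *)

Section Comatrix.
Variables (k : comPzRingType) (A B : alg k) (C : bimod A A) (cC : coring C).
Variables (L : rcomod B cC) (h : cohom L).
Local Notation X := (cohom_lcomod h).
Local Notation E := (cotens L X).
Local Notation Ek := (forget_left (cotens L X)).
Local Notation Lk := (rcomod_forget_left L).
Local Notation Bk := (forget_left (regular_bimod B)).
Local Notation G f := (cotens_map f (lcomod_id X)).
Local Notation T f := (tens_rcomod_hom f L).
Local Notation tc := (@tens_cotens k A B C cC L h).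
Variable ad : adjunction (cotens_functor X) (tens_functor L).
Local Notation eta M := (adj_unit ad M : rcomod_hom M (tens_rcomod (cotens M X) L)).
Local Notation eps V := (adj_counit ad V : bihom (cotens (tens_rcomod V L) X) V).

Section Coproduct.
Hypothesis etaE : forall (M : rcomodules cC) (m : M),
  tmap (cotens_val : bihom (cotens M X) (tens M X)) (bid L) (eta M m) =
  tassocV (tmap (bid M) (theta_bihom h) (rcoact M m)).

(** As the unit is given by theta, the left side applies rho_L and then theta, while [comatrix_map]
    starts from the coaction of X. The defining equation of L [] X exchanges the two. *)
Lemma incl_comatrix (z : E) :
  cotensor_val (G (T (cotens_incl h)) (G (unitL ad) (cotens_restr h z))) =
  tassocV (comatrix_map h (cotens_val z)).
Proof.
rewrite -cotens_map_comp.
pose f := bcomp tassocV (bcomp (tmap (bid L) (theta_bihom h)) (rcoact L)).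
pose fk := @Bihom k _ A Lk (tens (forget_left (tens L X)) L) f (bhomD f)
  (fun c l => bhoml f (alg_str B c) l) (bhomr f).
transitivity (tmap fk (bid X) (cotensor_val (cotens_restr h z))).
  apply: tmap_eq => // l.
  transitivity (tmap (cotens_incl h) (bid L) (tmap (cotens_unrestr h) (bid L) (eta Lk
    l))) => //.
  rewrite tmap_comp -[RHS](etaE (M := Lk) l).
  elim/tens_ind: (_ l : tens (cotens Lk X) L) => [z' l'|x y IHx IHy]; first by rewrite !tmapE.
  by rewrite bhomD IHx IHy; apply: esym; apply: (bhomD (tmap (cotens_val : bihom (cotens
    Lk X) (tens Lk X)) (bid L))).
transitivity (tmap f (bid X) (z : tens L X)) => //.
transitivity (tmap tassocV (bid X) (tmap (tmap (bid L) (theta_bihom h)) (bid X) (tmap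
  (rcoact L) (bid X) z))).
  by rewrite !tmap_comp.
rewrite cotensor_eq -tassocV_nat.
rewrite -[comatrix_map h _]/(tassocV (tmap (bid L) tassoc
    (tmap (bid L) (tmap (theta_bihom h) (bid X)) (tmap (bid L) (lcoact X) z)))).
rewrite tpentagonV.
have tassocK' Y : tmap (bid L) tassocV (tmap (bid L) tassoc Y) = Y :> tens L (tens (tens
  X L) X).
  rewrite tmap_comp -[RHS]tmap_id; apply: tmap_eq => // x; exact: tassocK.
by rewrite tassocK'.
Qed.

Lemma incl_tens (y : tens E E) :
  cotensor_val (G (T (cotens_incl h)) (tc Ek y)) = tassocV (tmap cotens_val cotens_val y).
Proof.
elim/tens_ind: y => [e z|x y IHx IHy].
  rewrite tmapE -[LHS]/(tmap (tmap (cotens_incl h) (bid L)) (bid X) (tassocV (tmap (bid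
    Ek) cotens_val (pure e z)))).
  by rewrite tmapE -tassocV_nat tmapE; congr (tassocV (pure _ _)); rewrite tmap_id.
rewrite [tmap cotens_val _ _]bhomD [RHS]bhomD -IHx -IHy.
by rewrite [tc Ek _](bhomD (tc Ek)) [G _ _]bhomD.
Qed.

Lemma comul_comatrix (D : E -> tens E E) :
  (forall z, tc Ek (D z) = G (unitL ad) (cotens_restr h z)) ->
  forall z, tmap cotens_val cotens_val (D z) = comatrix_map h (cotens_val z).
Proof.
move=> DE z; apply: (can_inj (@tassocVK _ _ _ _ _ _ _ _)).
by rewrite -incl_comatrix -DE -incl_tens.
Qed.

Hypothesis mono : cotens_incl_mono h.

(** The converse of [comul_comatrix]. An equation inside (L (x) X) (x) (L (x) X) has to be lifted to
    E (x) E, which is the purpose of [mono]. *)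
Lemma comatrix_comul (D : E -> tens E E) :
  (forall z, tmap cotens_val cotens_val (D z) = comatrix_map h (cotens_val z)) ->
  forall z, tc Ek (D z) = G (unitL ad) (cotens_restr h z).
Proof.
move=> DE z; apply: mono; apply: cotensor_inj.
by rewrite incl_comatrix -DE -incl_tens.
Qed.

Lemma incl_tens_inj : injective (tmap (cotens_val : bihom E _) (cotens_val : bihom E _)).
Proof.
move=> x y xy; apply: (@tens_cotens_inj _ _ _ _ _ _ h ad Ek); apply: mono; apply: cotensor_inj.
by rewrite !incl_tens xy.
Qed.

End Coproduct.

Lemma counit_nat (V W : rmod B) (f : bihom V W) w : f (eps V w) = eps W (G (T f) w).
Proof. exact/esym/(congr1 (fun g : bihom (cotens (tens_rcomod V L) X) W => g w)
  (adj_counit_nat ad f)). Qed.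

Lemma counit_unit (M : rcomodules cC) w : eps (cotens M X) (G (eta M) w) = w.
Proof. by move: (adj_triangle_l ad M) => /(congr1 (fun g : bihom (cotens M X) (cotens M
  X) => g w)). Qed.

Lemma unit_counit (V : rmod B) w : tmap (eps V) (bid L) (eta (tens_rcomod V L) w) = w.
Proof.
exact: (congr1 (fun g : rcomod_hom (tens_rcomod V L) (tens_rcomod V L) => g w)
  (adj_triangle_r ad V)).
Qed.

Definition insB (V : rmod B) (v : V) : bihom Bk V.
Proof.
exists (fun b : B => ract v b) => [x y|c x|x s].
- exact: ractDr.
- by rewrite ractM base_act lractA.
- exact: ractM.
Defined.

Definition lmulB (b : B) : bihom Bk Bk := lmul_hom (regular_bimod B) b.

Definition cotens_one : bihom (cotens (tens_rcomod Bk L) X) Ek :=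
  bcomp (cotens_unrestr h) (G (unit_rcomod_hom L)).

Lemma cotens_oneK w : tc Bk (pure (1 : regular_bimod B) (cotens_one w)) = w.
Proof.
rewrite tens_cotensE [cotens_restr _ _](@cotens_unrestrK _ _ _ _ _ _ h) -cotens_map_comp.
apply: cotens_map_id => y.
elim/tens_ind: y => [b l|x y IHx IHy]; last by rewrite bhomD IHx IHy.
rewrite -[LHS]/(pure (1 : regular_bimod B) (tunitl (pure (b : regular_bimod B) l))) tunitlE.
by rewrite -[RHS]/(pure (b : regular_bimod B) l) -[b in RHS]mul1r -pure_bal.
Qed.

Lemma cotens_one_tens (y : tens (regular_bimod B) E) : cotens_one (tc Bk y) = tunitl y.
Proof.
elim/tens_ind: y => [b z|x y IHx IHy]; last first.
  rewrite [RHS]bhomD -IHx -IHy [tc Bk _](bhomD (tc Bk)); exact: (bhomD cotens_one).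
rewrite tunitlE.
have -> : pure (b : regular_bimod B) z = pure (1 : regular_bimod B) (lact b z).
  by rewrite -pure_bal -[ract _ _]/(1 * b) mul1r.
rewrite [tc Bk _]tens_cotensE; apply: (can_inj (@cotens_restrK _ _ _ _ _ _ h)).
rewrite [LHS](@cotens_unrestrK _ _ _ _ _ _ h) -cotens_map_comp; apply: cotens_map_id => l.
by rewrite -[LHS]/(tunitl (pure (1 : regular_bimod B) l)) tunitlE lact1.
Qed.

Definition counit_fun : bihom Ek Bk := bcomp (eps Bk) (bcomp (tc Bk) (@tins k B B Bk E (1
  : regular_bimod B))).

Lemma counit_lact (b : B) (z : E) : counit_fun (lact b z) = b * counit_fun z :> B.
Proof.
rewrite -[RHS]/(lmulB b (counit_fun z)) [RHS]counit_nat; congr (eps Bk _).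
rewrite -tens_cotens_nat [tmap _ _ _]tmapE; congr (tc Bk _).
rewrite -[LHS](pure_bal (M := regular_bimod B) (N := E)).
by congr pure; rewrite /= mul1r mulr1.
Qed.

Definition counit : bihom E (regular_bimod B) :=
  @Bihom k B B E (regular_bimod B) counit_fun (bhomD counit_fun) counit_lact (bhomr counit_fun).

(** Naturality of the counit at b |-> v b determines it from its component at B. *)
Lemma counit_tens (V : rmod B) (w : tens V E) : eps V (tc V w) = tunitr (tmap (bid V) counit w).
Proof.
elim/tens_ind: w => [v z|x y IHx IHy]; last by rewrite !bhomD IHx IHy.
rewrite tmapE tunitrE -[RHS]/(insB v (counit_fun z)) [RHS]counit_nat; congr (eps V _).
rewrite -tens_cotens_nat [tmap _ _ _]tmapE; congr (tc V (pure _ _)).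
by rewrite -[RHS]/(ract v 1) ract1.
Qed.

Lemma counit_unitL l : tmap counit_fun (bid L) (unitL ad l) = pure (1 : regular_bimod B) l.
Proof.
pose g := @rins k A C cC B Bk L (1 : regular_bimod B).
transitivity (tmap (eps Bk) (bid L) (tmap (G g) (bid L) (eta Lk l))).
  rewrite -[LHS]/(tmap counit_fun (bid L) (tmap (cotens_unrestr h) (bid L) (eta Lk l))).
  rewrite !tmap_comp; apply: tmap_eq => // z.
  rewrite -[LHS]/(eps Bk (tc Bk (@tins k B B Bk E (1 : regular_bimod B) (cotens_unrestr h z)))).
  by rewrite [tc Bk _]tens_cotensE cotens_unrestrK.
by rewrite -cotens_unit_nat unit_counit.
Qed.

(** * Existence of the comatrix coring *)

Section Existence.
Hypothesis etaE : forall (M : rcomodules cC) (m : M),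
  tmap (cotens_val : bihom (cotens M X) (tens M X)) (bid L) (eta M m) =
  tassocV (tmap (bid M) (theta_bihom h) (rcoact M m)).
Hypothesis mono : cotens_incl_mono h.

Definition coproduct_fun : bihom Ek (tens Ek E) :=
  bcomp (tens_cotens_inv ad Ek) (bcomp (G (unitL ad)) (cotens_restr h)).

Lemma coproduct_funE z : tc Ek (coproduct_fun z) = G (unitL ad) (cotens_restr h z).
Proof. exact: tens_cotens_invK. Qed.

(** The construction through right modules gives right linearity only. Left linearity is inherited
    from the bimodule map [comatrix_map] through the injection [incl_tens_inj]. *)
Lemma coproduct_lact (b : B) (z : E) :
  coproduct_fun (lact b z) = lact b (coproduct_fun z : tens E E).
Proof.
apply: (incl_tens_inj mono); have e := comul_comatrix etaE coproduct_funE.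
rewrite [LHS]e; transitivity (lact b (tmap cotens_val cotens_val (coproduct_fun z : tens E E))).
  by rewrite e -bhoml.
by rewrite -bhoml.
Qed.

Definition coproduct : bihom E (tens E E) :=
  @Bihom k B B E (tens E E) coproduct_fun (bhomD coproduct_fun) coproduct_lact
    (bhomr coproduct_fun).

Lemma coproductE z : tc Ek (coproduct z) = G (unitL ad) (cotens_restr h z).
Proof. exact: coproduct_funE. Qed.

Lemma coproductA z :
  tassoc (tmap coproduct (bid E) (coproduct z)) = tmap (bid E) coproduct (coproduct z).
Proof.
apply: (can_inj (@tassocVK _ _ _ _ _ _ _ _)); rewrite tassocK.
apply: (@tens_cotens_inj _ _ _ _ _ _ h ad (tens Ek E)).
transitivity (G (tens_unit ad Ek) (tc Ek (coproduct z))); last first.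
  exact/esym/(tens_cotens_comul coproductE).
rewrite [LHS](tens_cotens_nat (comulk coproduct)) coproductE.
rewrite -!cotens_map_comp; apply: cotens_map_eq => l.
exact: (unit_comul coproductE l).
Qed.

(** The two counit laws are the two triangle identities: [unit_counit], by way of [counit_unitL],
    here, and [counit_unit] for the right law. *)
Lemma coproduct_counitl z : tunitl (tmap counit (bid E) (coproduct z)) = z.
Proof.
rewrite -cotens_one_tens [tc Bk _](tens_cotens_nat counit_fun) coproductE.
rewrite -!cotens_map_comp.
apply: (can_inj (@cotens_restrK _ _ _ _ _ _ h)).
rewrite [LHS](@cotens_unrestrK _ _ _ _ _ _ h) -cotens_map_comp; apply: cotens_map_id => l.
rewrite -[LHS]/(tunitl (tmap counit_fun (bid L) (unitL ad l) : tens (regular_bimod B) L)).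
by rewrite counit_unitL tunitlE lact1.
Qed.

Lemma coproduct_counitr z : tunitr (tmap (bid E) counit (coproduct z)) = z.
Proof.
rewrite -[LHS](counit_tens (V := Ek)) coproductE.
have -> : G (unitL ad) (cotens_restr h z) =
    G (T (cotens_unrestr h)) (G (eta Lk) (cotens_restr h z)).
  by rewrite -cotens_map_comp.
by rewrite -counit_nat counit_unit cotens_restrK.
Qed.

Lemma comatrix_coring_exists : exists E : coring (cotens L X), is_comatrix_coring E.
Proof.
exists (Coring coproductA coproduct_counitl coproduct_counitr); split.
  exact: comul_comatrix etaE _ coproductE.
by exists ad; split=> [M m|V w]; [apply: etaE | apply: counit_tens].
Qed.

End Existence.
End Comatrix.

(** * Frobenius systems *)

Section FrobeniusSystem.
Variables (k : comPzRingType) (B : alg k) (E : bimod B B) (cE : coring E).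
Variables (mu : bihom (tens E E) E) (e : E).
Hypothesis mu_right : forall z, comul cE (mu z) =
  tmap mu (bid E) (tassocV (tmap (bid E) (comul cE) z)).
Hypothesis mu_left : forall z, comul cE (mu z) =
  tmap (bid E) mu (tassoc (tmap (comul cE) (bid E) z)).
Hypothesis mul_e : forall z, mu (pure z e) = z.
Hypothesis e_mul : forall z, mu (pure e z) = z.

Let pairing : bihom (tens E E) (regular_bimod B) := bcomp (coeps cE) mu.

Lemma tunitl_pairing z :
  tunitl (tmap pairing (bid E) (tassocV (tmap (bid E) (comul cE) z))) = mu z.
Proof.
rewrite -[RHS](coepsl cE) mu_right tmap_comp; congr (tunitl _); exact: tmap_eq.
Qed.

Lemma tunitr_pairing z :
  tunitr (tmap (bid E) pairing (tassoc (tmap (comul cE) (bid E) z))) = mu z.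
Proof.
rewrite -[RHS](coepsr cE) mu_left tmap_comp; congr (tunitr _); exact: tmap_eq.
Qed.

Section Dual.
Local Notation dual := (bihom (forget_left E) (forget_left (regular_bimod B))).

(** The inverse of H. Writing <-,-> for [pairing], H returns <z, e_1> e_2 = mu(z (x) e) = z;
    conversely <f(e_1) e_2, c> = f(e_1 <e_2, c>) = f(mu(e (x) c)) = f(c). *)
Definition pairing_dual (z : E) : dual.
Proof.
refine (@Bihom k _ B (forget_left E) (forget_left (regular_bimod B))
  (fun c : E => pairing (pure z c)) _ _ _) => [x y|c x|x s].
- by rewrite pureDr bhomD.
- transitivity (lact (alg_str B c) (pairing (pure z x))); last by [].
  rewrite -bhoml lact_pure [lact _ z]act_sym pure_bal //.
- by rewrite -ract_pure bhomr.
Defined.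

Lemma dual_map_pairing z : dual_map cE e (pairing_dual z) = z.
Proof.
rewrite -[RHS]mul_e -tunitl_pairing tmapE; congr (tunitl _).
elim/tens_ind: (comul cE e) => [a b|x y IHx IHy].
  by rewrite [LHS]tmapE tassocVE [RHS]tmapE.
by rewrite pureDr !bhomD -IHx -IHy.
Qed.

Lemma pairing_dual_map (f : dual) : pairing_dual (dual_map cE e f) = f.
Proof.
apply: bihom_ext => c; rewrite -[in RHS](e_mul c) -tunitr_pairing tmapE.
rewrite -[LHS]/(pairing (pure (tunitl (tmap f (bid E) (comul cE e) : tens (regular_bimod
  B) E)) c)).
elim/tens_ind: (comul cE e) => [a b|x y IHx IHy].
  rewrite [tmap f _ _]tmapE tunitlE tassocE tmapE tunitrE bhomr.
  by rewrite -lact_pure bhoml.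
by rewrite !(pureDl, bhomD) -IHx -IHy.
Qed.

Lemma dual_map_bij : bijective (dual_map cE e).
Proof. exact: Bijective pairing_dual_map dual_map_pairing. Qed.

End Dual.

Hypothesis e_central : forall b, lact b e = ract e b.

(** Right B-linearity of v |-> v (x) e is centrality of e. *)
Definition cofree_unit (V : rmod B) : bihom V (tens V E).
Proof.
exists (fun v => pure v e) => [x y|c x|x s].
- exact: pureDl.
- by rewrite lact_pure.
- by rewrite pure_bal e_central ract_pure.
Defined.

Definition cofree_counit (V : rmod B) : bihom (tens V E) V :=
  bcomp tunitr (tmap (bid V) (coeps cE)).

Local Notation U := (forget_functor cE (base_alg k)).
Local Notation R := (tens_functor (coring_rcomod cE)).

Lemma forget_cofree_adjunction : adjunction U R.
Proof.
exists (fun M : rcomod_cat cE (base_alg k) => coact_hom M : hom M (R (U M)))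
  (fun V : bimod_cat (base_alg k) B => cofree_counit V : hom (U (R V)) V).
- by move=> M N f; apply/esym/(@coact_hom_nat k B E cE M N f).
- move=> V W f; apply: bihom_ext => x.
  rewrite -[RHS]/(f (tunitr (tmap (bid V) (coeps cE) x))) -tunitr_nat.
  rewrite -[LHS]/(tunitr (tmap (bid W) (coeps cE) (tmap f (bid E) x))) !tmap_comp.
  by congr (tunitr _); apply: tmap_eq.
- move=> M; apply: bihom_ext => m; exact: rcoact_eps.
- move=> V; apply: rcomod_hom_ext => x.
  rewrite -[LHS]/(tmap (cofree_counit V) (bid E) (tassocV (tmap (bid V) (comul cE) x))).
  elim/tens_ind: x => [v z|x y IHx IHy]; last first.
    by rewrite [tmap (bid V) _ _]bhomD [tassocV _]bhomD [LHS]bhomD IHx IHy.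
  rewrite tmapE -[RHS]/(pure v z) -[z in RHS](coepsl cE).
  elim/tens_ind: (comul cE z) => [a b|x y IHx IHy]; last first.
    by rewrite pureDr [tassocV _]bhomD !bhomD pureDr IHx IHy.
  rewrite tassocVE !tmapE tunitlE -pure_bal; congr (pure _ _).
  by rewrite -[LHS]/(tunitr (tmap _ _ (pure v a))) tmapE tunitrE.
Qed.

(** The counit is m (x) c |-> m_0 <m_1, c>. The triangle at V (x) E reduces to [e_mul], the one at M
    to [mul_e] and the counit law of M. *)
Lemma cofree_forget_adjunction : adjunction R U.
Proof.
exists (fun V : bimod_cat (base_alg k) B => cofree_unit V : hom V (U (R V)))
  (fun M : rcomod_cat cE (base_alg k) => coact_retr mu_right mu_left M : hom (R (U M)) M).
- by move=> V W f; apply: bihom_ext => v; apply/esym/tmapE.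
- move=> M N f; apply: rcomod_hom_ext => z; exact/esym/coact_retr_nat.
- move=> V; apply: rcomod_hom_ext => x.
  elim/tens_ind: x => [v z|x y IHx IHy]; last by rewrite bhomD IHx IHy.
  rewrite -[LHS]/(coact_retr_fun mu (cofree_rcomod cE V) (tmap (cofree_unit V) (bid E)
    (pure v z))).
  rewrite tmapE -[LHS]/(tunitr (tmap (bid (tens V E)) pairing (tassoc
     (tmap (tens_coact V (coring_rcomod cE)) (bid E) (pure (pure v e) z))))) tmapE.
  rewrite -[tens_coact _ _ _]/(tassocV (tmap (bid V) (comul cE) (pure v e))) tmapE.
  rewrite -[RHS]/(pure v z) -[z in RHS]e_mul -tunitr_pairing tmapE.
  elim/tens_ind: (comul cE e) => [a b|x y IHx IHy]; last first.
    by rewrite !(pureDr, bhomD, pureDl) IHx IHy.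
  by rewrite tassocVE !tassocE !tmapE !tunitrE ract_pure.
- move=> M; apply: bihom_ext => m.
  rewrite -[RHS]/m -[m in RHS](rcoact_eps (r := M)).
  rewrite -[LHS]/(tunitr (tmap (bid M) pairing (tassoc
     (tmap (rcoact M) (bid E) (pure m e))))) tmapE.
  elim/tens_ind: (rcoact M m) => [a b|x y IHx IHy]; last first.
    by rewrite !(pureDl, bhomD) IHx IHy.
  by rewrite tassocE !tmapE -[pairing _]/(coeps cE (mu _)) mul_e.
Qed.

Lemma Frobenius_system : Frobenius_coring cE.
Proof.
exists R; split; constructor; [exact: forget_cofree_adjunction | exact:
  cofree_forget_adjunction].
Qed.

End FrobeniusSystem.

(** * Separability, coseparability and the Frobenius property *)

Section ComatrixCoring.
Variables (k : comPzRingType) (A B : alg k) (C : bimod A A) (cC : coring C).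
Variables (L : rcomod B cC) (h : cohom L).
Local Notation X := (cohom_lcomod h).
Local Notation E := (cotens L X).
Local Notation Ek := (forget_left (cotens L X)).
Local Notation Lk := (rcomod_forget_left L).
Local Notation Bk := (forget_left (regular_bimod B)).
Local Notation G f := (cotens_map f (lcomod_id X)).
Local Notation T f := (tens_rcomod_hom f L).
Local Notation tc := (@tens_cotens k A B C cC L h).
Variable cE : coring E.
Variable ad : adjunction (cotens_functor X) (tens_functor L).
Local Notation eta M := (adj_unit ad M : rcomod_hom M (tens_rcomod (cotens M X) L)).
Local Notation eps V := (adj_counit ad V : bihom (cotens (tens_rcomod V L) X) V).
Hypothesis epsE : forall (V : rmod B) (w : tens V E),
  eps V (tc V w) = tunitr (tmap (bid V) (coeps cE) w).
Hypothesis comulE : forall z, tc Ek (comul cE z) = G (unitL ad) (cotens_restr h z).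

Lemma coeps_one w : coeps cE (cotens_one h w) = eps Bk w.
Proof.
rewrite -[in RHS](cotens_oneK w) [RHS](epsE (V := Bk)) tmapE tunitrE.
by rewrite -[RHS]/(1 * coeps cE (cotens_one h w)) mul1r.
Qed.

Lemma cotens_one_lact (b : B) w :
  cotens_one h (G (T (lmulB b)) w) = lact b (cotens_one h w : E).
Proof.
rewrite -[in LHS](cotens_oneK w) -tens_cotens_nat tmapE [LHS]cotens_one_tens tunitlE.
by rewrite -[lmulB b _]/(b * 1) mulr1.
Qed.

(** [P] applied to the unit at T V is a natural section of the counit. At V = B it is left linear by
    naturality at left multiplications of B. *)
Lemma separable_cosplit : separable_functor (tens_functor L) -> cosplit cE.
Proof.
case=> P [Pf Pnat].
pose CC := bimod_cat (base_alg k) B; pose DD := rcomod_cat cC (base_alg k).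
pose F := tens_functor L.
have Pl (V W W' : CC) (v : hom W W') (g : hom (F V) (F W)) :
    P V W' (compm (fmap F v) g) = compm v (P V W g).
  by rewrite -[g]compm1 -[in LHS](fmap1 F) Pnat !compm1.
have Pr (V V' W : CC) (v : hom V' V) (g : hom (F V) (F W)) :
    P V' W (compm g (fmap F v)) = compm (P V W g) v.
  by rewrite -[compm g _]comp1m -[in LHS](fmap1 F) Pnat !comp1m.
pose sg (V : CC) : hom V (cotens_functor X (F V)) := P V _ (adj_unit ad (F V)).
have sg_eps (V : CC) : compm (adj_counit ad V) (sg V) = idm V.
  by rewrite -Pl adj_triangle_r -(Pf V V (idm V)) fmap1.
have sg_nat (V W : CC) (f : hom V W) :
    compm (sg W) f = compm (fmap (cotens_functor X) (fmap F f)) (sg V).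
  by rewrite -Pr -Pl adj_unit_nat.
pose s0 : bihom Bk Ek := bcomp (cotens_one h) (sg Bk : bihom _ _).
have s0l (b : B) (x : regular_bimod B) : s0 (lact b x) = lact b (s0 x : E).
  have e := congr1 (fun g : bihom Bk _ => g x) (sg_nat _ _ (lmulB b : hom (Bk : CC) Bk)).
  by rewrite -[LHS]/(cotens_one h ((sg Bk : bihom _ _) (lmulB b x))) [(sg Bk : bihom _ _) _]e
     [LHS]cotens_one_lact.
exists (@Bihom k B B (regular_bimod B) E s0 (bhomD s0) s0l (bhomr s0)) => b.
rewrite -[LHS]/(coeps cE (cotens_one h ((sg Bk : bihom _ _) b))) coeps_one.
exact: (congr1 (fun g : bihom Bk Bk => g b) (sg_eps Bk)).
Qed.

Definition ins_section (s : bihom (regular_bimod B) E) (V : rmod B) : bihom V (tens V E).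
Proof.
exists (fun v => pure v (s 1)) => [x y|c x|x b].
- exact: pureDl.
- by rewrite lact_pure.
- rewrite pure_bal ract_pure -bhoml -bhomr; congr (pure _ (s _)).
  by rewrite -[LHS]/(b * 1) -[RHS]/(1 * b) mulr1 mul1r.
Defined.

(** Centrality of s(1) makes v |-> v (x) s(1) a natural section of the counit, up to [tens_cotens].
    The left inverse sends g to this section, followed by G g and the counit. *)
Lemma cosplit_separable : cosplit cE -> separable_functor (tens_functor L).
Proof.
case=> s sK.
exists (fun (V W : rmod B) (g : rcomod_hom (tens_rcomod V L) (tens_rcomod W L)) =>
  bcomp (eps W) (bcomp (G g) (bcomp (tc V) (ins_section s V)))); split=> [V W f|V V' W W'
    u v g].
  apply: bihom_ext => x.
  rewrite -[LHS]/(eps W (G (T f) (tc V (pure x (s 1))))) -counit_nat epsE tmapE tunitrE sK.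
  by rewrite ract1.
apply: bihom_ext => x.
rewrite -[LHS]/(eps W' (G (rcomod_comp (T v) (rcomod_comp g (T u))) (tc V' (pure x (s 1))))).
rewrite !cotens_map_comp -counit_nat; congr (bfun v (eps W (G g _))).
by rewrite -tens_cotens_nat tmapE.
Qed.

Lemma separable_coseparable : separable_functor h -> coseparable cE.
Proof.
move=> hsep; have [n [n_nat nK]] := separable_left_adjoint (cohom_adj h) ad hsep.
pose m (M : rcomodules cC) : rcomod_hom (tens_rcomod (cotens M X) L) M := n M.
have m_nat (M N : rcomodules cC) (f : rcomod_hom M N) y : f (m M y) = m N (T (G f) y).
  exact: (congr1 (fun g : rcomod_hom _ N => g y) (n_nat M N f)).
exists (mult m_nat); split.
- apply: (mult_comul comulE) => M x.
  exact: (congr1 (fun g : rcomod_hom M M => g x) (nK M)).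
- exact: (mult_right comulE).
- exact: (mult_left comulE).
Qed.

Section Frobenius.
Variable xi : adjunction (tens_functor L) (cotens_functor X).
Local Notation e := (unit_elt xi).
Local Notation xiu V := (adj_unit xi V : bihom V (cotens (tens_rcomod V L) X)).

Definition xi_counit (M : rcomodules cC) : rcomod_hom (tens_rcomod (cotens M X) L) M :=
  adj_counit xi M.

Lemma xi_counit_nat (M N : rcomodules cC) (f : rcomod_hom M N) y :
  f (xi_counit M y) = xi_counit N (T (G f) y).
Proof. exact/esym/(congr1 (fun g : rcomod_hom _ N => g y) (adj_counit_nat xi f)). Qed.

Lemma xi_unit (V : rmod B) v : xiu V v = tc V (pure v e).
Proof.
have e1 := congr1 (fun g : bihom Bk _ => g (1 : B))
  (adj_unit_nat xi (insB v : hom (Bk : bimod_cat (base_alg k) B) V)).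
transitivity (G (T (insB v)) (xiu Bk (1 : B))).
  by rewrite -[RHS]e1; congr (xiu V _); rewrite -[RHS]/(ract v 1) ract1.
rewrite -[xiu Bk _ in LHS]cotens_oneK -tens_cotens_nat tmapE; congr (tc V (pure _ _)).
by rewrite -[LHS]/(ract v 1) ract1.
Qed.

(** The element xi_B(b) is computed twice: as b e by [xi_unit], which is naturality, and as e b by
    right linearity of xi_B. *)
Lemma unit_elt_central (b : B) : lact b e = ract e b.
Proof.
have e1 : xiu Bk (b : B) = ract (xiu Bk (1 : B)) b.
  by rewrite -bhomr; congr (xiu Bk _); rewrite -[RHS]/(1 * b) mul1r.
have := congr1 (cotens_one h) e1; rewrite !xi_unit bhomr !cotens_one_tens !tunitlE.
by rewrite lact1.
Qed.

Local Notation mu := (mult xi_counit_nat).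

(** The unit laws for e are the triangle identities of [xi]: the one at L here, the one at B in
    [unit_elt_mult]. *)
Lemma mult_unit_elt (z : E) : mu (pure z e) = z.
Proof.
apply: (can_inj (@cotens_restrK _ _ _ _ _ _ h)); rewrite [LHS]mult_restr.
rewrite -[tc Ek _]xi_unit cotens_map_comp.
have e1 := congr1 (fun g : bihom Ek _ => g z)
  (adj_unit_nat xi (cotens_restr h : hom (Ek : bimod_cat (base_alg k) B) _)).
rewrite -[X in G _ X]e1.
exact: (congr1 (fun g : bihom (cotens Lk X) (cotens Lk X) => g (cotens_restr h z))
  (adj_triangle_r xi Lk)).
Qed.

Lemma unit_elt_mult (z : E) : mu (pure e z) = z.
Proof.
apply: (can_inj (@cotens_restrK _ _ _ _ _ _ h)); rewrite [LHS]mult_restr.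
rewrite [tc Ek _]tens_cotensE -cotens_map_comp; apply: cotens_map_id => l.
transitivity (unit_rcomod_hom L (xi_counit (tens_rcomod Bk L)
   (tmap (xiu Bk) (bid L) (pure (1 : regular_bimod B) l)))).
  rewrite xi_counit_nat -[LHS]/(xi_counit Lk (tmap (cotens_restr h) (bid L) (pure (e : Ek) l))).
  congr (xi_counit Lk _); rewrite !tmapE; congr pure.
  exact: cotens_unrestrK.
have e1 := congr1 (fun g : rcomod_hom (tens_rcomod Bk L) (tens_rcomod Bk L) =>
  g (pure (1 : regular_bimod B) l)) (adj_triangle_l xi Bk).
rewrite [X in unit_rcomod_hom L X]e1.
by rewrite -[LHS]/(tunitl (pure (1 : regular_bimod B) l)) tunitlE lact1.
Qed.

Lemma Frobenius_comatrix : bijective (dual_map cE e) /\ Frobenius_coring cE.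
Proof.
split.
  exact: (dual_map_bij (mult_right comulE _) (mult_left comulE _) mult_unit_elt unit_elt_mult).
exact: (Frobenius_system (mult_right comulE _) (mult_left comulE _) mult_unit_elt unit_elt_mult
  unit_elt_central).
Qed.

End Frobenius.
End ComatrixCoring.

Theorem theorem3p1p8 (k : comPzRingType) (A B : alg k) (C : bimod A A)
  (cC : coring C) (L : rcomod B cC) (h : cohom L) :
  lflat C ->
  (rflat C /\ cohom_exact h) \/ coseparable cC ->
  let X := cohom_lcomod h in
  (exists E : coring (cotens L X), is_comatrix_coring E) /\
  forall E : coring (cotens L X), is_comatrix_coring E ->
  [/\ separable_functor (tens_functor L) <-> cosplit E,
      separable_functor h -> coseparable E
    & Frobenius_functor (tens_functor L) ->
      (rflat X /\ coflat L) \/ coseparable cC ->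
      forall xi : adjunction (tens_functor L) (cotens_functor X),
      let H := dual_map E (unit_elt xi) in
      let H_central := forall f b, lact b (H f) = ract (H f) b in
      [/\ bijective H,
          bijective (alg_str B) -> H_central
        & H_central -> Frobenius_coring E]].
Proof.
move=> Cflat hyp X.
have hC : cohom_exact h \/ coseparable cC by case: hyp => [[_ ?]|?]; [left|right].
have mono := cotens_incl_monoP Cflat hC; split.
  have [ad etaE] := cotens_adjunction hC.
  exact: comatrix_coring_exists etaE mono.
move=> E [comulE [ad [etaE epsE]]].
have DE := comatrix_comul etaE mono comulE.
split.
- by split; [apply: separable_cosplit epsE | apply: cosplit_separable epsE].
- exact: separable_coseparable DE.
move=> _ _ xi H H_central; have [Hbij EF] := Frobenius_comatrix DE xi.
(* When k -> B is bijective, every b comes from k, whose two actions on a bimodule coincide. *)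
split=> // -[g _ gK] f b.
by rewrite -[b]gK act_sym.
Qed.
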